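(* Let $\Sigma\in\mathbf{S}_n$ be positive semidefinite, let $A\in\mathbb{R}^{n\times n}$ satisfy $\Sigma=A^TA$, and let $a_1,\dots,a_n\in\mathbb{R}^n$ be the columns of $A$. Let $\rho$ satisfy $0<\rho<\min_{1\le i\le n}\Sigma_{ii}$. Define $$\phi(\rho)=\max_{\|x\|_2=1}\ x^T\Sigma x-\rho\,\mathrm{Card}(x),$$ $$\psi(\rho)=\max_{X\succeq 0,\ \mathrm{Tr}(X)=1}\ \sum_{i=1}^n\mathrm{Tr}\left(X^{1/2}a_ia_i^TX^{1/2}-\rho X\right)_+ .$$ Let $X$ be an optimal solution of the problem defining $\psi(\rho)$ and let $r=\mathrm{rank}(X)$. Then $$n\rho\;\vartheta_r\!\left(\frac{\psi(\rho)}{n\rho}\right)\ \le\ \phi(\rho)\ \le\ \psi(\rho),$$ where $$\vartheta_r(x)=\mathbf{E}\left[\left(x\,\xi_1^2-\frac{1}{r-1}\sum_{j=2}^r\xi_j^2\right)_+\right]$$ and $\xi_1,\dots,\xi_r$ are independent standard normal random variables.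
   Context: $\mathbf{S}_n$ is the set of real symmetric $n\times n$ matrices, and $X\succeq 0$ means that $X$ is (symmetric) positive semidefinite. $\mathrm{Card}(x)$ is the number of nonzero coefficients of $x\in\mathbb{R}^n$. For a symmetric matrix $M$, $\mathrm{Tr}(M)_+$ denotes the sum of the positive eigenvalues of $M$ (i.e. the trace of the positive part of $M$); for a real number $t$, $t_+=\max\{t,0\}$. $X^{1/2}$ is the positive semidefinite square root of $X$. When $r=1$, the term $\frac{1}{r-1}\sum_{j=2}^r\xi_j^2$ in $\vartheta_r$ is an empty sum and is interpreted as $0$. *)

(* Defs.v *)
From HB Require Import structures.
From mathcomp Require Import all_boot all_order all_algebra finmap.
From mathcomp Require Import all_classical all_reals all_analysis.

Set Implicit Arguments.
Unset Strict Implicit.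
Unset Printing Implicit Defensive.

Import Order.TTheory GRing.Theory Num.Theory.
Import numFieldNormedType.Exports.

Local Open Scope classical_set_scope.
Local Open Scope ring_scope.

Section matrices.
Context {R : realType} {n : nat}.
Implicit Types (x : 'cV[R]_n) (M X Sigma A : 'M[R]_n).

Definition norm2 x : R := Num.sqrt (\sum_i x i 0 ^+ 2).

Definition Card x : nat := #|[set i | x i 0 != 0]%SET|.

Definition psd X : Prop :=
  X^T = X /\ forall x, 0 <= (x^T *m X *m x) 0 0.

(* For [psd X] the set below is a singleton; 0 is an irrelevant default. *)
Definition psd_sqrt X : 'M[R]_n :=
  xget 0 [set Y : 'M[R]_n | psd Y /\ Y *m Y = X].

(* Each positive eigenvalue is counted with its multiplicity in [char_poly M];
   [char_poly M] is nonzero, so the support is finite and [\sum_(_ \in _)] is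
   a genuine finite sum. *)
Definition tr_pos M : R :=
  \sum_(a \in [set a | eigenvalue M a && (0 < a)]) (a *+ mup a (char_poly M)).

End matrices.

(* The maximum of S when it is attained (it is then unique), and 0 otherwise. *)
Definition max_of {R : realType} (S : set R) : R :=
  xget 0 [set m | S m /\ ubound S m].

Section problems.
Context {R : realType} {n : nat}.
Implicit Types (Sigma A X : 'M[R]_n) (rho : R).

Definition phi Sigma rho : R :=
  max_of [set (x^T *m Sigma *m x) 0 0 - rho * (Card x)%:R
         | x in [set x : 'cV[R]_n | norm2 x = 1]].

Definition psi_feasible X : Prop := psd X /\ \tr X = 1.

Definition psi_objective A rho X : R :=
  \sum_(i < n)
    tr_pos (psd_sqrt X *m col i A *m (col i A)^T *m psd_sqrt X - rho *: X).

Definition psi A rho : R :=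
  max_of [set psi_objective A rho X | X in psi_feasible].

Definition psi_optimal A rho X : Prop :=
  psi_feasible X /\
  forall Y, psi_feasible Y -> psi_objective A rho Y <= psi_objective A rho X.

End problems.

Section gaussian.
Context {d : measure_display} {T : measurableType d} {R : realType}
        {P : probability T R}.

(* Mutual independence of the subfamily of [X] indexed by [D]. *)
Definition mutually_independent {I : choiceType} (D : set I)
    (X : I -> {RV P >-> R}) : Prop :=
  forall (J : {fset I}) (B : I -> set R),
    [set` J] `<=` D -> (forall i, measurable (B i)) ->
    P (\bigcap_(i in [set` J]) (X i @^-1` B i)) =
    (\prod_(i <- J) P (X i @^-1` B i))%E.

Definition standard_normal (X : {RV P >-> R}) : Prop :=
  forall B : set R, measurable B -> distribution P X B = normal_prob 0 1 B.

(* [xi] is indexed from 1 and only [xi 1], ..., [xi r] are used.  For r = 1 the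
   factor [(r%:R - 1)^-1] is [0^-1 = 0] and the sum is empty. *)
Definition vartheta (xi : nat -> {RV P >-> R}) (r : nat) (x : R) : \bar R :=
  'E_P[fun t => Num.max
         (x * xi 1%N t ^+ 2
          - (r%:R - 1)^-1 * \sum_(2 <= j < r.+1) xi j t ^+ 2) 0].

End gaussian.

(* Main.v *)
Require Import Defs.
From HB Require Import structures.
From mathcomp Require Import all_boot all_order all_algebra finmap.
From mathcomp Require Import all_classical all_reals all_analysis.
From mathcomp Require Import measurable_realfun ring lra.

(** Write a_i for the columns of A and, for a unit vector z, let g(z) be the sum
    over i of ((a_i^T z)^2 - rho)_+.

    Upper bound. The value phi is the maximum of g over the unit sphere
    ([phi_eq_max]). Given a unit vector x, the vector z = A x / |A x| does at
    least as well for g, since x^T Sigma x = |A x|^2 only involves the support of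
    x. Conversely, the coefficients a_i^T z with (a_i^T z)^2 > rho form, once
    normalized, a vector x which does at least as well as z. Both inequalities
    are Cauchy-Schwarz. For a unit vector z the matrix z z^T is feasible for the
    relaxation and its objective is at least g(z) ([tr_pos_outer_ge]), hence
    phi <= psi.

    Lower bound. Factor the optimal matrix as X = W W^T with r columns
    ([psd_factorization]), and round a standard Gaussian vector xi of R^r to
    W xi ([gaussian_rounding]). By homogeneity, the sum over i of
    ((a_i^T W xi)^2 - rho |W xi|^2)_+ is at most phi |W xi|^2, whose expectation
    is at most phi Tr(X) = phi. The i-th summand is the positive part at xi of
    the quadratic form C_i = W^T (a_i a_i^T - rho) W. This form is the difference
    of a rank-one form and a positive semidefinite one, so it has at most one
    positive eigenvalue; this eigenvalue is the trace s_i of the positive part in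
    the i-th term of psi ([tr_pos_one_positive_direction],
    [tr_pos_compressed]), and Tr(C_i) >= s_i - rho
    ([compressed_form_trace]). Rotate its eigenvector to the first axis. The
    expectation of (xi^T C_i xi)_+ then decreases when the rest of the form is
    replaced by its average over the other axes ([gaussian_trace_averaging]):
    multiply by the indicator of the event where the averaged form is positive;
    by symmetry of this event, the off-diagonal moments vanish and the diagonal
    moments other than the first one coincide, so that only the trace of the
    rest of the form matters. Therefore
      E (s_i xi_1^2 - rho / (r - 1) * (xi_2^2 + ... + xi_r^2))_+
        <= E (xi^T C_i xi)_+.
    Summing over i, the left-hand sides are together at least
    E (psi xi_1^2 - n rho / (r - 1) * (xi_2^2 + ... + xi_r^2))_+, because the
    positive part is subadditive, and this is n rho vartheta_r(psi / (n rho)).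

    Rotation invariance of the Gaussian law is reduced to reflections of
    coordinate planes, whose products bring any vector to the first axis
    ([reflection_to_axis]). Such a reflection is composed of shears and a sign
    change, which preserve the Lebesgue measure of the plane by Fubini and
    translation invariance ([plane_integral_reflection]), while the Gaussian
    density only depends on the radius ([normal_prod_reflection]). *)

Set Implicit Arguments.
Unset Strict Implicit.
Unset Printing Implicit Defensive.

Import Order.TTheory GRing.Theory Num.Theory.
Import numFieldNormedType.Exports.

Local Open Scope classical_set_scope.
Local Open Scope ring_scope.

(** * Inner products and positive semidefinite matrices *)

Section positive_semidefinite.
Context {R : realType} {n : nat}.
Implicit Types (x y z : 'cV[R]_n) (X M : 'M[R]_n).

Lemma dot_sqr_ge0 x : 0 <= (x^T *m x) 0 0.
Proof. by rewrite mxE sumr_ge0// => i _; rewrite mxE -expr2 sqr_ge0. Qed.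

Lemma dot_eq0 x : (x^T *m x) 0 0 = 0 -> x = 0.
Proof.
rewrite mxE => /eqP; rewrite psumr_eq0; last first.
  by move=> i _; rewrite mxE -expr2 sqr_ge0.
move=> /allP h; apply/colP => i; have := h i (mem_index_enum i).
by rewrite /= !mxE -expr2 sqrf_eq0 => /eqP.
Qed.

Lemma dot_gt0 x : x != 0 -> 0 < (x^T *m x) 0 0.
Proof.
move=> x0; rewrite lt_neqAle dot_sqr_ge0 andbT eq_sym.
by apply: contra x0 => /eqP/dot_eq0 ->.
Qed.

Lemma unit_neq0 x : (x^T *m x) 0 0 = 1 -> x != 0.
Proof.
move=> x1; apply/eqP => x0; move: x1.
by rewrite x0 mulmx0 mxE => /esym/eqP; rewrite oner_eq0.
Qed.

Lemma dotC x y : (x^T *m y) 0 0 = (y^T *m x) 0 0.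
Proof. by rewrite !mxE; apply: eq_bigr => i _; rewrite !mxE mulrC. Qed.

Lemma quadratic_formZ M (k : R) x :
  ((k *: x)^T *m M *m (k *: x)) 0 0 = k ^+ 2 * (x^T *m M *m x) 0 0.
Proof.
rewrite (_ : (k *: x)^T = k *: x^T); last by rewrite linearZ.
by rewrite -!scalemxAl -scalemxAr scalerA -expr2 mxE.
Qed.

Lemma dotZ (k : R) x : ((k *: x)^T *m (k *: x)) 0 0 = k ^+ 2 * (x^T *m x) 0 0.
Proof. by have := quadratic_formZ 1%:M k x; rewrite !mulmx1. Qed.

Definition normalize x : 'cV[R]_n := (Num.sqrt ((x^T *m x) 0 0))^-1 *: x.

Lemma normalize_coefE x : x != 0 ->
  (Num.sqrt ((x^T *m x) 0 0))^-1 ^+ 2 = ((x^T *m x) 0 0)^-1.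
Proof. by move=> x0; rewrite exprVn sqr_sqrtr// dot_sqr_ge0. Qed.

Lemma normalize_unit x : x != 0 ->
  ((normalize x)^T *m normalize x) 0 0 = 1.
Proof.
by move=> x0; rewrite dotZ normalize_coefE// mulVf// gt_eqF// dot_gt0.
Qed.

Lemma bilinearC M x y : M^T = M -> (x^T *m M *m y) 0 0 = (y^T *m M *m x) 0 0.
Proof. by move=> MT; rewrite -mulmxA dotC trmx_mul MT. Qed.

Lemma bilinear_combination M (a b : R) x y : M^T = M ->
  ((a *: x + b *: y)^T *m M *m (a *: x + b *: y)) 0 0 =
  a ^+ 2 * (x^T *m M *m x) 0 0 + 2 * a * b * (x^T *m M *m y) 0 0 +
  b ^+ 2 * (y^T *m M *m y) 0 0.
Proof.
move=> MT; have -> : (a *: x + b *: y)^T = a *: x^T + b *: y^T.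
  by rewrite linearD !linearZ.
rewrite !mulmxDl !mulmxDr -!scalemxAl -!scalemxAr.
have yx := bilinearC y x MT; move: yx.
move: (x^T *m M *m x) (x^T *m M *m y) (y^T *m M *m x) (y^T *m M *m y) => p q r s.
by rewrite !mxE => ->; ring.
Qed.

Lemma psd_cauchy_schwarz X x y : psd X ->
  (x^T *m X *m y) 0 0 ^+ 2 <= (x^T *m X *m x) 0 0 * (y^T *m X *m y) 0 0.
Proof.
move=> [XT X0].
have := X0 y; have := X0 x.
have h a b : 0 <= a ^+ 2 * (x^T *m X *m x) 0 0 +
    2 * a * b * (x^T *m X *m y) 0 0 + b ^+ 2 * (y^T *m X *m y) 0 0.
  by rewrite -bilinear_combination.
move: h; move: ((x^T *m X *m x) 0 0 : R) ((y^T *m X *m y) 0 0 : R)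
  ((x^T *m X *m y) 0 0 : R).
clear X0 XT => p q s h p0 q0.
have [q_eq0|q_neq0] := eqVneq q 0.
  (* When q = 0 the form is affine in b, so s = 0: otherwise this choice of
     coefficients makes it negative. *)
  have [->|s0] := eqVneq s 0; first by rewrite q_eq0 expr0n mulr0.
  have := h (2 * s) (- (p + 1)); rewrite q_eq0 => h1.
  have s2 : 0 < s ^+ 2 by rewrite exprn_even_gt0.
  by exfalso; nra.
have q_gt0 : 0 < q by rewrite lt_neqAle eq_sym q_neq0.
have h1 : 0 <= q * (p * q - s ^+ 2) by have := h q (- s); congr (_ <= _); ring.
by move: h1; rewrite pmulr_rge0// subr_ge0.
Qed.

Lemma psd1 : psd (1%:M : 'M[R]_n).
Proof. by split=> [|x]; rewrite ?trmx1// mulmx1 dot_sqr_ge0. Qed.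

Lemma cauchy_schwarz x y :
  (x^T *m y) 0 0 ^+ 2 <= (x^T *m x) 0 0 * (y^T *m y) 0 0.
Proof. by have := psd_cauchy_schwarz x y psd1; rewrite !mulmx1. Qed.

Lemma delta_formE M i j :
  ((delta_mx i 0 : 'cV[R]_n)^T *m M *m (delta_mx j 0 : 'cV[R]_n)) 0 0 = M i j.
Proof. by rewrite trmx_delta -rowE -colE !mxE. Qed.

Lemma delta_unit i :
  ((delta_mx i 0 : 'cV[R]_n)^T *m (delta_mx i 0 : 'cV[R]_n)) 0 0 = 1.
Proof. by rewrite -[X in X *m _]mulmx1 delta_formE mxE eqxx. Qed.

Lemma psd_diag_ge0 X i : psd X -> 0 <= X i i.
Proof. by move=> [_ X0]; rewrite -delta_formE. Qed.

Lemma psd_diag_eq0 X : psd X -> (forall i, X i i = 0) -> X = 0.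
Proof.
move=> pX X0; apply/matrixP => i j; rewrite mxE.
have := psd_cauchy_schwarz (delta_mx i 0) (delta_mx j 0) pX.
rewrite !delta_formE !X0 mulr0 => h.
by apply/eqP; rewrite -sqrf_eq0 eq_le h sqr_ge0.
Qed.

Lemma mul_tr_psd m (W : 'M[R]_(n, m)) : psd (W *m W^T).
Proof.
split=> [|x]; first by rewrite trmx_mul trmxK.
have -> : x^T *m (W *m W^T) *m x = (W^T *m x)^T *m (W^T *m x).
  by rewrite trmx_mul trmxK !mulmxA.
by rewrite mxE sumr_ge0// => i _; rewrite mxE -expr2 sqr_ge0.
Qed.

End positive_semidefinite.

(** Cholesky factorization with as many columns as the rank: subtracting the
    rank-one matrix built on a column with nonzero pivot keeps the matrix
    positive semidefinite, by Cauchy-Schwarz, and kills that column, so the rank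
    drops. *)
Lemma psd_factorization (R : realType) n r (X : 'M[R]_n) : psd X ->
  (\rank X <= r)%N -> exists W : 'M[R]_(n, r), X = W *m W^T.
Proof.
elim: r X => [|r IH] X pX rX.
  exists 0; rewrite mul0mx; apply/eqP; rewrite -mxrank_eq0.
  by move: rX; rewrite leqn0.
have [/forallP X0|/forallPn[i Xi]] := boolP [forall i, X i i == 0].
  exists 0; rewrite mul0mx; apply: psd_diag_eq0 => // i.
  exact/eqP.
have c0 : 0 < X i i by rewrite lt_neqAle eq_sym Xi psd_diag_ge0.
have [XT Xge0] := pX.
pose w : 'cV[R]_n := (Num.sqrt (X i i))^-1 *: col i X.
have wE (x : 'cV[R]_n) : (w^T *m x) 0 0 =
    (Num.sqrt (X i i))^-1 * ((delta_mx i 0 : 'cV[R]_n)^T *m X *m x) 0 0.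
  rewrite /w linearZ /= -scalemxAl mxE; congr (_ * _).
  by rewrite colE trmx_mul XT.
have wwE (x : 'cV[R]_n) : (x^T *m (w *m w^T) *m x) 0 0 = (w^T *m x) 0 0 ^+ 2.
  by rewrite mulmxA -mulmxA mxE big_ord1 expr2 ord1 (dotC x w).
pose X' := X - w *m w^T.
have pX' : psd X'.
  split=> [|x]; first by rewrite linearB /= XT trmx_mul trmxK.
  have sc := psd_cauchy_schwarz (delta_mx i 0) x pX.
  have -> : (x^T *m X' *m x) 0 0 =
      (x^T *m X *m x) 0 0 - (x^T *m (w *m w^T) *m x) 0 0.
    by rewrite mulmxBr mulmxBl mxE [X in _ + X]mxE.
  rewrite wwE wE exprMn exprVn (sqr_sqrtr (ltW c0)) subr_ge0 mulrC.
  by rewrite ler_pdivrMr// mulrC -delta_formE.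
have rX' : (\rank X' <= r)%N.
  rewrite -ltnS; apply: leq_trans rX; apply: rank_ltmx.
  pose ei : 'cV[R]_n := delta_mx i 0.
  have wwT : w *m w^T = (X i i)^-1 *: (X *m ei *m ei^T) *m X.
    rewrite -scalemxAl /w.
    rewrite (_ : (_ *: col i X)^T = (Num.sqrt (X i i))^-1 *: (col i X)^T).
      rewrite -scalemxAl -scalemxAr scalerA -expr2 exprVn (sqr_sqrtr (ltW c0)).
      by rewrite colE trmx_mul XT mulmxA.
    by rewrite linearZ.
  rewrite ltmxE; apply/andP; split.
    by apply/submxP; exists (1%:M - (X i i)^-1 *: (X *m ei *m ei^T));
      rewrite mulmxBl mul1mx -wwT.
  (* X' kills ei and X does not, so the rows of X are not spanned by X'. *)
  apply/negP => /submxP[D XD].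
  have : X *m ei = 0.
    rewrite XD -mulmxA mulmxBl wwT -!scalemxAl.
    have -> : X *m ei *m ei^T *m X *m ei = X i i *: (X *m ei).
      have e : ei^T *m X *m ei = (X i i)%:M.
        by rewrite [LHS]mx11_scalar -[in RHS](delta_formE X i i).
      by rewrite -!mulmxA (mulmxA ei^T) e mulmxA mul_mx_scalar.
    by rewrite scalerA mulVf// scale1r subrr mulmx0.
  move/(congr1 (fun v : 'cV[R]_n => v i 0)); rewrite /ei -colE !mxE => Xii.
  by rewrite Xii eqxx in Xi.
have [W XW] := IH _ pX' rX'.
have VV : row_mx w W *m (row_mx w W)^T = X.
  by rewrite tr_row_mx mul_row_col -XW /X' addrC subrK.
by exists (row_mx w W).
Qed.

(** * Reflections of coordinate planes *)

Section reflections.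
Context {R : realType} {r : nat}.
Implicit Types (i j : 'I_r) (c s : R) (z : 'cV[R]_r).

(** The rows (c, s) and (s, - c) in the plane of the coordinates i and j. With
    c ^+ 2 + s ^+ 2 = 1 this family contains the sign change of one coordinate
    and the exchange of two. *)
Definition reflection i j c s : 'M[R]_r := \matrix_(k, l)
  (if k == i then c *+ (l == i) + s *+ (l == j)
   else if k == j then s *+ (l == i) - c *+ (l == j) else (k == l)%:R).

Lemma reflectionE i j c s z k : (reflection i j c s *m z) k 0 =
  if k == i then c * z i 0 + s * z j 0
  else if k == j then s * z i 0 - c * z j 0 else z k 0.
Proof.
have sumE (a : R) (l : 'I_r) : \sum_m a *+ (m == l) * z m 0 = a * z l 0.
  rewrite (bigD1 l)//= eqxx mulr1n big1 ?addr0// => m /negPf->.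
  by rewrite mulr0n mul0r.
rewrite mxE; case: ifP => ki.
  under eq_bigr do rewrite mxE ki mulrDl.
  by rewrite big_split /= !sumE.
case: ifP => kj.
  under eq_bigr do rewrite mxE ki kj mulrBl.
  by rewrite sumrB /= !sumE.
under eq_bigr do rewrite mxE ki kj eq_sym.
by rewrite sumE mul1r.
Qed.

Lemma tr_reflection i j c s : i != j ->
  (reflection i j c s)^T = reflection i j c s.
Proof.
move=> ij; apply/matrixP => k l; rewrite !mxE.
have ji : (j == i) = false by rewrite eq_sym (negPf ij).
have [->|ki] := eqVneq k i; have [->|li] := eqVneq l i => //=;
  (have [?|kj] := eqVneq k j); (have [?|lj] := eqVneq l j); subst => //=;
  rewrite ?eqxx ?ji ?(negPf ij) ?mulr0n ?addr0 ?add0r ?subr0 ?(negPf kj);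
  rewrite ?(negPf lj) ?oppr0 //;
  first [by rewrite (negPf ki)|by rewrite [k == l]eq_sym].
Qed.

Lemma reflectionK i j c s : i != j -> c ^+ 2 + s ^+ 2 = 1 ->
  reflection i j c s *m reflection i j c s = 1%:M.
Proof.
move=> ij cs1; apply/matrixP => k l.
transitivity ((reflection i j c s *m
    (reflection i j c s *m delta_mx l 0 : 'cV_r)) k 0).
  by rewrite mulmxA -colE !mxE.
have ji : (j == i) = false by rewrite eq_sym (negPf ij).
rewrite !reflectionE !eqxx ji !mxE !andbT.
have [->|ki] := eqVneq k i; first by rewrite -[RHS]mul1r -cs1; ring.
have [->|kj] := eqVneq k j; last by [].
by rewrite -[RHS]mul1r -cs1; ring.
Qed.

(** An inductive description rather than orthogonality itself: invariance
    properties then only have to be checked on plane reflections. *)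
Inductive reflection_product : 'M[R]_r -> Prop :=
| reflection_product1 : reflection_product 1%:M
| reflection_productM i j c s Q : i != j -> c ^+ 2 + s ^+ 2 = 1 ->
    reflection_product Q -> reflection_product (reflection i j c s *m Q).

Lemma reflection_product_orthogonal Q : reflection_product Q -> Q^T *m Q = 1%:M.
Proof.
elim=> [|i j c s {}Q ij cs1 _ QQ]; first by rewrite trmx1 mulmx1.
rewrite trmx_mul tr_reflection// -mulmxA (mulmxA (reflection _ _ _ _)).
by rewrite reflectionK// mul1mx.
Qed.

End reflections.

(** The coordinates other than 0 are cleared one after the other, each by a
    reflection of its plane with coordinate 0. The image is only known up to a
    scalar: in dimension one there is no plane to reflect in. *)
Lemma reflection_to_axis (R : realType) m (u : 'cV[R]_m.+1) :
  exists2 Q, reflection_product Q & exists x, Q *m u = x *: delta_mx 0 0.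
Proof.
suff kill k : (k <= m)%N -> exists2 Q, reflection_product Q &
    forall l : 'I_m.+1, (0 < l <= k)%N -> (Q *m u) l 0 = 0.
  have [Q QP Q0] := kill m (leqnn m).
  exists Q => //; exists ((Q *m u) 0 0); apply/colP => l; rewrite !mxE eqxx andbT.
  have [->|l0] := eqVneq l 0; first by rewrite mulr1.
  by have := Q0 l; rewrite mulr0 mxE => ->//; rewrite lt0n l0 -ltnS ltn_ord.
elim: k => [|k IH] km.
  by exists 1%:M; [exact: reflection_product1|move=> l; case: (nat_of_ord l)].
have [Q QP Q0] := IH (ltnW km).
pose y := Q *m u; pose j : 'I_m.+1 := inord k.+1.
have jE : j = k.+1 :> nat by rewrite inordK.
have j0 : 0 != j by rewrite -val_eqE /= jE.
have [yj0|yj0] := eqVneq (y j 0) 0.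
  exists Q => // l /andP[l0]; rewrite leq_eqVlt => /orP[/eqP lk|lk].
    by rewrite (_ : l = j)//; apply: val_inj; rewrite /= jE.
  by rewrite Q0// l0.
pose h := Num.sqrt (y 0 0 ^+ 2 + y j 0 ^+ 2).
have h2 : h ^+ 2 = y 0 0 ^+ 2 + y j 0 ^+ 2.
  by rewrite sqr_sqrtr// addr_ge0 ?sqr_ge0.
have h0 : h != 0.
  by rewrite -sqrf_eq0 h2 paddr_eq0 ?sqr_ge0// !sqrf_eq0 negb_and yj0 orbT.
exists (reflection 0 j (y 0 0 / h) (y j 0 / h) *m Q).
  apply: reflection_productM => //.
  by rewrite !expr_div_n -mulrDl -h2 divff// expf_neq0.
move=> l /andP[l0 lk]; rewrite -mulmxA reflectionE -/y.
have -> : (l == 0) = false by apply/negbTE; rewrite -val_eqE /= -lt0n.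
have [_|lj] := eqVneq l j; first by field.
apply: Q0; rewrite l0 -ltnS ltn_neqAle lk andbT -jE.
by apply: contra lj => /eqP/val_inj ->.
Qed.

(** * The trace of the positive part *)

Lemma char_poly_orthogonal_conj (R : comNzRingType) n (Q M : 'M[R]_n) :
  Q *m Q^T = 1%:M -> char_poly (Q *m M *m Q^T) = char_poly M.
Proof.
move=> QQ; rewrite /char_poly.
have -> : char_poly_mx (Q *m M *m Q^T) =
    map_mx polyC Q *m char_poly_mx M *m map_mx polyC Q^T.
  rewrite /char_poly_mx mulmxBr mulmxBl -!map_mxM; congr (_ - _).
  by rewrite scalar_mxC -mulmxA -map_mxM QQ map_mx1 mulmx1.
rewrite !det_mulmx mulrAC -det_mulmx -map_mxM QQ map_mx1.
by rewrite det1 mul1r.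
Qed.

Section trace_positive_part.
Context {R : realType}.

Lemma eigenvalue_unit_vector n (M : 'M[R]_n) a : M^T = M -> eigenvalue M a ->
  exists2 v : 'cV[R]_n, (v^T *m v) 0 0 = 1 & M *m v = a *: v.
Proof.
move=> MT /eigenvalueP[w wM w0].
have wT0 : w^T != 0.
  by apply: contra w0 => /eqP/(congr1 trmx); rewrite trmxK trmx0 => ->.
exists (normalize w^T); first exact: normalize_unit.
rewrite /normalize; move: (_^-1) => k.
rewrite -scalemxAr -[M in LHS]MT -trmx_mul wM scalerA mulrC -scalerA.
by congr (_ *: _); rewrite linearZ.
Qed.

Lemma eigenvector_eigenvalue n (M : 'M[R]_n) a (v : 'cV[R]_n) : M^T = M -> v != 0 ->
  M *m v = a *: v -> eigenvalue M a.
Proof.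
move=> MT v0 Mv; apply/eigenvalueP; exists v^T; last first.
  by apply: contra v0 => /eqP/(congr1 trmx); rewrite trmxK trmx0 => ->.
by rewrite -{1}MT -trmx_mul Mv linearZ.
Qed.

Lemma eigenvector_orthogonal n (M : 'M[R]_n) a b (v w : 'cV[R]_n) : M^T = M ->
  M *m v = a *: v -> M *m w = b *: w -> a != b -> (v^T *m w) 0 0 = 0.
Proof.
move=> MT Mv Mw ab.
have : (v^T *m M *m w) 0 0 = b * (v^T *m w) 0 0.
  by rewrite -mulmxA Mw -scalemxAr mxE.
rewrite bilinearC// -mulmxA Mv -scalemxAr mxE dotC => /eqP.
by rewrite -subr_eq0 -mulrBl mulf_eq0 subr_eq0 (negPf ab) => /eqP.
Qed.

(** For a symmetric matrix: at most one eigenvalue is positive, and its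
    eigenspace is a line. *)
Definition one_positive_direction n (M : 'M[R]_n) : Prop :=
  forall a b (v w : 'cV[R]_n), 0 < a -> 0 < b -> v != 0 -> w != 0 ->
    (v^T *m w) 0 0 = 0 -> M *m v = a *: v -> M *m w = b *: w -> False.

Lemma axis_eigenvector_block n (N : 'M[R]_n.+1) a : N^T = N ->
  N *m delta_mx 0 0 = a *: (delta_mx 0 0 : 'cV[R]_n.+1) ->
  N = @block_mx _ 1 n 1 n a%:M 0 0 (@drsubmx _ 1 n 1 n N).
Proof.
move=> NT Ne.
have Nk k : N k 0 = a * (k == 0)%:R.
  have := congr1 (fun v : 'cV[R]_n.+1 => v k 0) Ne.
  by rewrite -colE !mxE andbT.
have N0k k : N 0 k = a * (k == 0)%:R by rewrite -NT mxE.
have l0 (i : 'I_1) : lshift n i = 0 :> 'I_n.+1 by rewrite ord1; exact: val_inj.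
rewrite -[LHS](@submxK _ 1 n 1 n); congr (@block_mx _ 1 n 1 n _ _ _ _).
- by apply/matrixP => i j; rewrite !ord1 !mxE l0 Nk mulr1.
- by apply/matrixP => i j; rewrite !mxE l0 N0k mulr0.
- by apply/matrixP => i j; rewrite !mxE l0 Nk mulr0.
Qed.

(** Deflation: in an orthonormal basis starting with the eigenvector v, the
    matrix is the direct sum of the scalar a and a matrix N2, and a root a of
    the characteristic polynomial of N2 would give a second positive
    eigenvector, orthogonal to v. *)
Lemma mup_char_poly_simple n (M : 'M[R]_n) a (v : 'cV[R]_n) : M^T = M ->
  one_positive_direction M -> 0 < a -> v != 0 -> M *m v = a *: v ->
  mup a (char_poly M) = 1%N.
Proof.
case: n M v => [|n] M v MT M1 a0 v0 Mv.
  by rewrite (flatmx0 v) eqxx in v0.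
have [Q QP [x Qv]] := reflection_to_axis v.
have QQ := reflection_product_orthogonal QP.
have QQ' : Q *m Q^T = 1%:M by exact: mulmx1C.
have vE : v = x *: (Q^T *m delta_mx 0 0).
  by rewrite scalemxAr -Qv mulmxA QQ mul1mx.
have x0 : x != 0 by apply: contra v0 => /eqP x0; rewrite vE x0 scale0r.
pose N := Q *m M *m Q^T.
have NT : N^T = N by rewrite /N !trmx_mul trmxK MT mulmxA.
have Ne : N *m delta_mx 0 0 = a *: (delta_mx 0 0 : 'cV[R]_n.+1).
  apply: (scalerI x0); rewrite scalemxAr -Qv /N -!mulmxA (mulmxA Q^T) QQ mul1mx.
  by rewrite Mv -scalemxAr Qv !scalerA mulrC.
pose N2 : 'M[R]_n := @drsubmx _ 1 n 1 n N.
have Nblock : N = @block_mx _ 1 n 1 n a%:M 0 0 N2.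
  exact: axis_eigenvector_block.
rewrite -(char_poly_orthogonal_conj M QQ') -/N Nblock /char_poly.
rewrite (@char_block_diag_mx _ 1 n) (@det_ublock _ 1 n).
have -> : \det (char_poly_mx (a%:M : 'M[R]_1)) = 'X - a%:P.
  by rewrite det_mx11 !mxE eqxx !mulr1n.
rewrite mupMl; first by rewrite -['X - _]expr1 mup_XsubCX eqxx.
rewrite -/(char_poly N2) -eigenvalue_root_char; apply/negP => /eigenvalueP[w wN w0].
pose w' : 'cV[R]_n.+1 := (@row_mx _ 1 1 n 0 w *m Q)^T.
apply: (M1 a a v w') => //.
- apply: contra w0 => /eqP/(congr1 trmx); rewrite trmxK trmx0 => h.
  have := congr1 (mulmx^~ Q^T) h; rewrite -mulmxA QQ' mulmx1 mul0mx.
  rewrite -[RHS](@row_mx0 _ 1 1 n) => h0.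
  by have [_ ->] := @eq_row_mx _ 1 1 n _ _ _ _ h0.
- rewrite dotC /w' trmxK -mulmxA Qv -scalemxAr.
  rewrite -colE 2!mxE; apply/eqP; rewrite mulf_eq0 (negPf x0) /=; apply/eqP.
  rewrite (_ : 0 = lshift n (0 : 'I_1)); last exact: val_inj.
  by rewrite row_mxEl mxE.
rewrite /w' -[M in LHS]MT -trmx_mul -[RHS]linearZ /=; congr (_^T).
have wN' : @row_mx _ 1 1 n 0 w *m N = a *: @row_mx _ 1 1 n 0 w.
  rewrite Nblock (@mul_row_block _ 1 1 n 1 n) mulmx0 !mul0mx !add0r wN.
  by rewrite (@scale_row_mx _ 1 1 n) scaler0.
by rewrite scalemxAl -wN' /N -!mulmxA QQ mulmx1.
Qed.

(** The only case in which [tr_pos] is used: there is a single positive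
    eigenvalue, if any, and it is counted once. *)
Lemma tr_pos_one_positive_direction n (M : 'M[R]_n) : M^T = M ->
  one_positive_direction M ->
  (tr_pos M = 0 /\ (forall a, 0 < a -> ~~ eigenvalue M a)) \/
  exists2 v : 'cV[R]_n, (v^T *m v) 0 0 = 1 &
    0 < tr_pos M /\ M *m v = tr_pos M *: v.
Proof.
move=> MT M1; rewrite /tr_pos.
set S := [set a | _].
have [S0|/set0P[a [/= /andP[Ma a0]]]] := eqVneq S set0.
  left; split; first by rewrite S0 fsbig_set0.
  move=> a a0; apply/negP => Ma; have : S a by rewrite /S /= Ma a0.
  by rewrite S0.
right; have [v v1 Mv] := eigenvalue_unit_vector MT Ma.
have v0 := unit_neq0 v1.
have SE : S = [set a].
  apply/seteqP; split => [b /= /andP[Mb b0]|_ ->]; last by rewrite /S /= Ma a0.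
  have [w w1 Mw] := eigenvalue_unit_vector MT Mb.
  apply/eqP/contraT => ba; exfalso.
  apply: (M1 b a w v) => //; first exact: unit_neq0.
  exact: (eigenvector_orthogonal MT Mw Mv).
exists v; rewrite // SE fsbig_set1 (mup_char_poly_simple MT M1 a0 v0 Mv).
by rewrite mulr1n.
Qed.

End trace_positive_part.

(** * The terms of the semidefinite relaxation *)

Section objective_terms.
Context {R : realType} {n : nat}.
Implicit Types (X Y : 'M[R]_n) (a z : 'cV[R]_n) (rho : R).

(** The second case is the default value of [xget]; the form considered below is
    then - rho *: X, which has no positive eigenvalue. *)
Lemma psd_sqrt_cases X :
  (psd_sqrt X)^T = psd_sqrt X /\
  (psd_sqrt X *m psd_sqrt X = X \/ psd_sqrt X = 0).
Proof.
rewrite /psd_sqrt; case: xgetP => [Y _ [[YT _] YY]|_]; first by split=> //; left.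
by rewrite trmx0; split=> //; right.
Qed.

Lemma rank1_shift_sym X Y a rho : X^T = X -> Y^T = Y ->
  (Y *m a *m a^T *m Y - rho *: X)^T = Y *m a *m a^T *m Y - rho *: X.
Proof.
by move=> XT YT; rewrite linearB linearZ /= !trmx_mul trmxK XT YT !mulmxA.
Qed.

Let rank1_shiftE X Y a rho z : Y^T = Y ->
  (z^T *m (Y *m a *m a^T *m Y - rho *: X) *m z) 0 0 =
  (a^T *m Y *m z) 0 0 ^+ 2 - rho * (z^T *m X *m z) 0 0.
Proof.
move=> YT; rewrite mulmxBr mulmxBl -scalemxAr -scalemxAl.
rewrite mxE [X in _ + X]mxE [X in _ - X]mxE; congr (_ - _).
have -> : z^T *m (Y *m a *m a^T *m Y) *m z = (a^T *m Y *m z)^T *m (a^T *m Y *m z).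
  by rewrite !trmx_mul trmxK YT !mulmxA.
by rewrite mxE big_ord1 mxE expr2.
Qed.

(** If v and w were orthogonal eigenvectors with positive eigenvalues, the form
    would be positive on their span; but this plane contains a nonzero vector
    killed by a^T Y, at which the form is nonpositive. *)
Lemma rank1_shift_one_positive X Y a rho : psd X -> Y^T = Y -> 0 < rho ->
  one_positive_direction (Y *m a *m a^T *m Y - rho *: X).
Proof.
move=> pX YT rho0 al be v w al0 be0 v0 w0 vw Mv Mw.
set M := (_ - _) in Mv Mw; have MT : M^T = M by exact: rank1_shift_sym (proj1 pX) YT.
have quad z : (z^T *m M *m z) 0 0 = (a^T *m Y *m z) 0 0 ^+ 2 - rho * (z^T *m X *m z) 0 0.
  exact: rank1_shiftE.
have X0 z : 0 <= rho * (z^T *m X *m z) 0 0.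
  by rewrite mulr_ge0 ?(ltW rho0)// (proj2 pX).
have vMv : (v^T *m M *m v) 0 0 = al * (v^T *m v) 0 0.
  by rewrite -mulmxA Mv -scalemxAr mxE.
have wMw : (w^T *m M *m w) 0 0 = be * (w^T *m w) 0 0.
  by rewrite -mulmxA Mw -scalemxAr mxE.
have vMw : (v^T *m M *m w) 0 0 = 0.
  by rewrite -mulmxA Mw -scalemxAr mxE vw mulr0.
have v2 : 0 < al * (v^T *m v) 0 0 by rewrite mulr_gt0// dot_gt0.
have w2 : 0 < be * (w^T *m w) 0 0 by rewrite mulr_gt0// dot_gt0.
pose p := (a^T *m Y *m v) 0 0; pose q := (a^T *m Y *m w) 0 0.
have := quad (q *: v + (- p) *: w).
rewrite bilinear_combination// vMv wMw vMw mulr0 addr0.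
have -> : (a^T *m Y *m (q *: v + - p *: w)) 0 0 = 0.
  rewrite mulmxDr -!scalemxAr mxE [X in X + _]mxE [X in _ + X]mxE -/p -/q.
  by ring.
rewrite expr0n sub0r sqrrN => zMz.
have := X0 (q *: v + (- p) *: w); rewrite -[X in 0 <= X]opprK -zMz oppr_ge0 => h.
have hq : q ^+ 2 * (al * (v^T *m v) 0 0) = 0.
  apply/eqP; rewrite eq_le mulr_ge0 ?sqr_ge0 ?(ltW v2)// andbT.
  by apply: le_trans h; rewrite lerDl mulr_ge0 ?sqr_ge0 ?(ltW w2).
have hp : p ^+ 2 * (be * (w^T *m w) 0 0) = 0.
  move: h; rewrite hq add0r => h.
  by apply/eqP; rewrite eq_le h mulr_ge0 ?sqr_ge0 ?(ltW w2).
have p0 : p = 0.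
  by move/eqP: hp; rewrite mulf_eq0 (gt_eqF w2) orbF sqrf_eq0 => /eqP.
have := quad v; rewrite vMv -/p p0 expr0n sub0r => vX.
by move: v2; rewrite vX oppr_gt0 ltNge X0.
Qed.

(** With X = W W^T, the matrices Y (a a^T - rho) Y, where Y is the square root of
    X, and W^T (a a^T - rho) W have the same nonzero eigenvalues; the second one
    has the size of the rank of X. *)
Definition compressed_form m (W : 'M[R]_(n, m)) a rho : 'M[R]_m :=
  W^T *m (a *m a^T - rho%:M) *m W.

Lemma compressed_formE m (W : 'M[R]_(n, m)) a rho (u : 'cV[R]_m) :
  (u^T *m compressed_form W a rho *m u) 0 0 =
  (a^T *m (W *m u)) 0 0 ^+ 2 - rho * ((W *m u)^T *m (W *m u)) 0 0.
Proof.
have := @rank1_shiftE 1%:M 1%:M a rho (W *m u) (trmx1 _ _).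
rewrite !mul1mx !mulmx1 scalemx1 => <-.
by rewrite /compressed_form trmx_mul !mulmxA.
Qed.

(** The trace is the squared length of W^T a minus rho, and the form at a unit
    vector is at most that squared length, by Cauchy-Schwarz. *)
Lemma compressed_form_trace m (W : 'M[R]_(n, m)) a rho (u : 'cV[R]_m) :
  0 < rho -> \tr (W *m W^T) = 1 -> (u^T *m u) 0 0 = 1 ->
  (u^T *m compressed_form W a rho *m u) 0 0 - rho <= \tr (compressed_form W a rho).
Proof.
move=> rho0 trW u1.
have -> : \tr (compressed_form W a rho) = ((W^T *m a)^T *m (W^T *m a)) 0 0 - rho.
  rewrite /compressed_form mxtrace_mulC mulmxBr mul_mx_scalar mulmxBr -scalemxAr.
  rewrite linearB linearZ /= trW mulr1 mulmxA mxtrace_mulC -trace_mx11.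
  by rewrite mxtrace_mulC trmx_mul trmxK !mulmxA mxtrace_mulC !mulmxA.
rewrite lerD2r compressed_formE lerBlDr.
have := cauchy_schwarz (W^T *m a) u; rewrite u1 mulr1 trmx_mul trmxK -mulmxA => h.
by apply: le_trans h _; rewrite lerDl mulr_ge0 ?(ltW rho0)// dot_sqr_ge0.
Qed.

(** The eigenvector v of the large matrix is transported to the eigenvector
    W^T (a a^T - rho) Y v of the compressed one. *)
Lemma tr_pos_compressed m (W : 'M[R]_(n, m)) X a rho :
  psd X -> X = W *m W^T -> 0 < rho ->
  let t := tr_pos (psd_sqrt X *m a *m a^T *m psd_sqrt X - rho *: X) in
  t = 0 \/ exists2 u : 'cV[R]_m, (u^T *m u) 0 0 = 1 &
    (u^T *m compressed_form W a rho *m u) 0 0 = t.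
Proof.
move=> pX XW rho0 /=; have [YT YY] := psd_sqrt_cases X.
move: (psd_sqrt X) YT YY => Y YT YY.
have MT := rank1_shift_sym a rho (proj1 pX) YT.
have M1 := rank1_shift_one_positive (a := a) pX YT rho0.
have [[-> _]|[v v1 [t0 Mv]]] := tr_pos_one_positive_direction MT M1; first by left.
right; move: (tr_pos _) t0 Mv => t t0 Mv.
have vMv : t = (a^T *m Y *m v) 0 0 ^+ 2 - rho * (v^T *m X *m v) 0 0.
  by rewrite -rank1_shiftE// -mulmxA Mv -scalemxAr mxE v1 mulr1.
have {}YY : Y *m Y = X.
  case: YY => // Y0; move: t0; rewrite vMv Y0 mulmx0 mul0mx mxE expr0n sub0r.
  by rewrite oppr_gt0 ltNge mulr_ge0 ?(ltW rho0)// (proj2 pX).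
pose B := a *m a^T - rho%:M.
have ME : Y *m a *m a^T *m Y - rho *: X = Y *m B *m Y.
  by rewrite /B mulmxBr mulmxBl mul_mx_scalar -scalemxAl YY !mulmxA.
rewrite {}ME in Mv.
pose u := W^T *m B *m Y *m v.
have Wu : W *m u = t *: (Y *m v).
  have Mv' : Y *m (B *m (Y *m v)) = t *: v by rewrite -Mv !mulmxA.
  by rewrite /u !mulmxA -XW -YY -!mulmxA Mv' -scalemxAr.
have Cu : compressed_form W a rho *m u = t *: u.
  by rewrite /compressed_form -mulmxA Wu -scalemxAr /u !mulmxA.
have u0 : u != 0.
  apply/eqP => u0; move: Wu; rewrite u0 mulmx0 => /esym/eqP.
  rewrite scaler_eq0 (gt_eqF t0) /= => /eqP Yv.
  move: Mv; rewrite -mulmxA Yv mulmx0 => /esym/eqP.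
  by rewrite scaler_eq0 (gt_eqF t0) (negPf (unit_neq0 v1)).
exists (normalize u); first exact: normalize_unit.
rewrite -mulmxA -[_ *m normalize u]scalemxAr Cu scalerA mulrC -scalerA.
by rewrite -/(normalize u) -scalemxAr mxE normalize_unit// mulr1.
Qed.

(** A psd Y with Y Y = z z^T vanishes on the orthogonal complement of z, since
    its square does; hence Y is a nonnegative multiple of z z^T. *)
Lemma psd_sqrt_outer z : (z^T *m z) 0 0 = 1 -> psd_sqrt (z *m z^T) = z *m z^T.
Proof.
move=> z1; have zz : z^T *m z = 1%:M by rewrite [LHS]mx11_scalar z1.
rewrite /psd_sqrt; case: xgetP => [Y _ [[YT Y0] YY]|/(_ (z *m z^T))[]]; last first.
  by split; [exact: mul_tr_psd|rewrite mulmxA -(mulmxA z) zz mulmx1].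
have Yker : Y *m (1%:M - z *m z^T) = 0.
  apply/matrixP => i j; rewrite [RHS]mxE.
  pose k := col j (1%:M - z *m z^T).
  have Yk : Y *m k = 0.
    apply: dot_eq0; rewrite trmx_mul YT mulmxA -(mulmxA k^T Y Y) YY -mulmxA.
    suff -> : z *m z^T *m k = 0 by rewrite mulmx0 mxE.
    rewrite /k colE mulmxA mulmxBr mulmx1 [_ *m (z *m z^T)]mulmxA -(mulmxA z) zz.
    by rewrite mulmx1 subrr mul0mx.
  by have := congr1 (fun v : 'cV[R]_n => v i 0) Yk; rewrite /k colE mulmxA -colE !mxE.
have YzzT : Y = Y *m (z *m z^T).
  by apply/eqP; rewrite -subr_eq0 -{1}[Y]mulmx1 -mulmxBr Yker.
have zYE : Y = z *m (z^T *m Y *m z) *m z^T.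
  by rewrite {1}YzzT -[in LHS]YT {1}YzzT !trmx_mul trmxK YT !mulmxA.
have := zYE; rewrite (mx11_scalar (z^T *m Y *m z)) mul_mx_scalar -scalemxAl.
set c := (_ *m z) 0 0 => Yc.
have c0 : 0 <= c by exact: Y0.
have Yz : Y *m z = c *: z by rewrite Yc -scalemxAl -mulmxA zz mulmx1.
have c2 : c ^+ 2 = 1.
  have := congr1 (fun N : 'M[R]_n => (z^T *m (N *m z)) 0 0) YY.
  rewrite -mulmxA Yz -scalemxAr Yz scalerA -mulmxA zz mulmx1 -scalemxAr mxE z1.
  by rewrite mulr1.
have c1 : c = 1.
  apply/eqP; move/eqP: c2; rewrite sqrf_eq1 => /orP[//|/eqP cN].
  by move: c0; rewrite cN lerNr oppr0 ler10.
by rewrite Yc c1 scale1r.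
Qed.

(** At X = z z^T the matrix is the multiple of z z^T by (a^T z)^2 - rho. *)
Lemma tr_pos_outer_ge a z rho : 0 < rho -> (z^T *m z) 0 0 = 1 ->
  Num.max ((a^T *m z) 0 0 ^+ 2 - rho) 0 <=
  tr_pos (psd_sqrt (z *m z^T) *m a *m a^T *m psd_sqrt (z *m z^T) - rho *: (z *m z^T)).
Proof.
move=> rho0 z1; rewrite psd_sqrt_outer//.
have zz : z^T *m z = 1%:M by rewrite [LHS]mx11_scalar z1.
have pX := mul_tr_psd z; have XT := proj1 pX.
have M1 := rank1_shift_one_positive (a := a) pX XT rho0.
have MT := rank1_shift_sym a rho XT XT.
have ME : z *m z^T *m a *m a^T *m (z *m z^T) - rho *: (z *m z^T) =
    ((a^T *m z) 0 0 ^+ 2 - rho) *: (z *m z^T).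
  rewrite scalerBl; congr (_ - _).
  have az : a^T *m z = ((a^T *m z) 0 0)%:M by exact: mx11_scalar.
  have za : z^T *m a = ((a^T *m z) 0 0)%:M by rewrite dotC; exact: mx11_scalar.
  move: ((a^T *m z) 0 0 : R) az za => b az za.
  rewrite -!mulmxA (mulmxA a^T) az mul_scalar_mx -!scalemxAr (mulmxA z^T) za.
  by rewrite mul_scalar_mx -scalemxAr scalerA -expr2.
have z0 := unit_neq0 z1.
have Mz : (z *m z^T *m a *m a^T *m (z *m z^T) - rho *: (z *m z^T)) *m z =
    ((a^T *m z) 0 0 ^+ 2 - rho) *: z.
  by rewrite ME -scalemxAl -mulmxA zz mulmx1.
have [[-> nopos]|[v v1 [t0 Mv]]] := tr_pos_one_positive_direction MT M1.
  rewrite ge_max lexx andbT leNgt; apply/negP => b0.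
  by have := nopos _ b0; rewrite (eigenvector_eigenvalue MT z0 Mz).
rewrite ge_max (ltW t0) andbT; move: (tr_pos _) t0 Mv => t t0 Mv.
have [<-//|tb] := eqVneq t ((a^T *m z) 0 0 ^+ 2 - rho).
have vz := eigenvector_orthogonal MT Mv Mz tb.
move: Mv; rewrite ME -scalemxAl -mulmxA [z^T *m v]mx11_scalar (dotC z v) vz.
rewrite raddf0 mulmx0 scaler0 => /esym/eqP.
by rewrite scaler_eq0 (gt_eqF t0) (negPf (unit_neq0 v1)).
Qed.

End objective_terms.

(** * The sparse problem as a maximum over the sphere *)

Lemma continuous_sum (R : realType) (V : topologicalType) (I : Type) (s : seq I)
    (F : I -> V -> R) :
  (forall i, continuous (F i)) -> continuous (fun x => \sum_(i <- s) F i x).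
Proof.
move=> cF; apply: (@continuous_big R I +%R 0 predT) => //.
exact: add_continuous.
Qed.

Lemma sphere_max (R : realType) n (f : 'cV[R]_n.+1 -> R) :
  continuous (fun w : 'rV[R]_n.+1 => f w^T) ->
  exists2 c, (c^T *m c) 0 0 = 1 & forall z, (z^T *m z) 0 0 = 1 -> f z <= f c.
Proof.
move=> cf; pose nrm (w : 'rV[R]_n.+1) : R := \sum_i w 0 i ^+ 2.
have nrmE (w : 'rV[R]_n.+1) : nrm w = ((w^T)^T *m w^T) 0 0.
  by rewrite mxE; apply: eq_bigr => i _; rewrite trmxK mxE expr2.
have cnrm : continuous nrm.
  apply: continuous_sum => i x.
  apply: (@continuous_comp _ _ _ (fun w : 'rV[R]_n.+1 => w 0 i) (fun y => y ^+ 2)).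
    exact: coord_continuous.
  exact: exprn_continuous.
pose A := [set w | nrm w = 1].
have clA : closed A.
  apply: (@preimage_closed _ _ nrm [set y | y = 1]) => [w _|]; first exact: cnrm.
  exact: closed_eq.
have coA : compact A.
  have cube := @rV_compact R n.+1 (fun=> `[(-1 : R), 1]%classic)
    (fun=> @segment_compact R (-1) 1).
  apply: (subclosed_compact clA cube).
  move=> w nw i; rewrite /= in_itv /= -ler_norml -(@ler_pXn2r _ 2)// ?nnegrE//.
  rewrite expr1n -normrX ger0_norm ?sqr_ge0// -nw /nrm (bigD1 i)//= lerDl.
  by rewrite sumr_ge0// => j _; exact: sqr_ge0.
have A0 : A !=set0.
  exists (delta_mx 0 0); rewrite /A /= /nrm (bigD1 0)//= big1 ?addr0.
    by rewrite mxE !eqxx expr1n.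
  by move=> i i0; rewrite mxE eqxx (negPf i0) expr0n.
have [c] := EVT_max_rV A0 coA (continuous_subspaceT cf).
rewrite inE => cA cmax; exists c^T; first by rewrite -nrmE.
move=> z z1; rewrite -[z]trmxK; apply: cmax; rewrite inE /A /= nrmE !trmxK.
exact: z1.
Qed.

Lemma max_ofE (R : realType) (S : set R) m : S m -> ubound S m -> max_of S = m.
Proof.
move=> Sm um; rewrite /max_of; case: xgetP => [y _ [Sy uy]|/(_ m)[]//].
by apply/eqP; rewrite eq_le um//= uy.
Qed.

Lemma norm2_eq1 (R : realType) n (x : 'cV[R]_n) :
  norm2 x = 1 <-> (x^T *m x) 0 0 = 1.
Proof.
have -> : norm2 x = Num.sqrt ((x^T *m x) 0 0).
  by rewrite /norm2 mxE; congr Num.sqrt; apply: eq_bigr => i _; rewrite mxE expr2.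
split=> [|->]; last exact: sqrtr1.
by move/(congr1 (fun t => t ^+ 2)); rewrite sqr_sqrtr ?dot_sqr_ge0// expr1n.
Qed.

Section cardinality_penalty.
Context {R : realType} {n : nat}.
Implicit Types (Sigma A : 'M[R]_n.+1) (rho : R) (x y z : 'cV[R]_n.+1).

(** By the lemmas below, [phi] is the maximum of this function over the unit
    sphere, where the cardinality has disappeared. *)
Definition thresholded_energy A rho z : R :=
  \sum_i Num.max (((col i A)^T *m z) 0 0 ^+ 2 - rho) 0.

Lemma thresholded_energy_max A rho :
  exists2 c, (c^T *m c) 0 0 = 1 & forall z, (z^T *m z) 0 0 = 1 ->
    thresholded_energy A rho z <= thresholded_energy A rho c.
Proof.
apply: sphere_max; apply: continuous_sum => i w.
have cl : continuous (fun w : 'rV[R]_n.+1 => ((col i A)^T *m w^T) 0 0).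
  rewrite (_ : (fun w => _) = fun w : 'rV[R]_n.+1 => \sum_j A j i * w 0 j); last first.
    by apply/funext => v; rewrite mxE; apply: eq_bigr => j _; rewrite !mxE.
  apply: continuous_sum => j v.
  apply: (@continuousM _ _ (cst (A j i)) (fun w : 'rV[R]_n.+1 => w 0 j)).
    exact: cst_continuous.
  exact: coord_continuous.
apply: (@continuous_max _ _
  (fun w : 'rV[R]_n.+1 => ((col i A)^T *m w^T) 0 0 ^+ 2 - rho) (cst 0)); last first.
  exact: cst_continuous.
apply: (@continuousB _ R^o _ _ (cst rho)); last exact: cst_continuous.
apply: (@continuous_comp _ _ _ (fun w : 'rV[R]_n.+1 => ((col i A)^T *m w^T) 0 0)
  (fun y : R => y ^+ 2)); first exact: cl.
exact: exprn_continuous.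
Qed.

Let energyE A x : (x^T *m (A^T *m A) *m x) 0 0 = ((A *m x)^T *m (A *m x)) 0 0.
Proof. by rewrite trmx_mul !mulmxA. Qed.

Let cardE rho x : rho * (Card x)%:R = \sum_(i | x i 0 != 0) rho.
Proof. by rewrite sumr_const /Card cardsE mulr_natr. Qed.

Let col_dotE A i z : ((col i A)^T *m z) 0 0 = (A^T *m z) i 0.
Proof. by rewrite !mxE; apply: eq_bigr => j _; rewrite !mxE. Qed.

Let mask (p : pred 'I_n.+1) z : 'cV[R]_n.+1 := \col_i (if p i then z i 0 else 0).

Let mask_sqr p z : ((mask p z)^T *m mask p z) 0 0 = \sum_(i | p i) z i 0 ^+ 2.
Proof.
rewrite mxE [RHS]big_mkcond; apply: eq_bigr => i _; rewrite !mxE.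
by case: ifP => _; rewrite ?mulr0// expr2.
Qed.

(** With z = A x / |A x|, the value x^T Sigma x = |A x|^2 is the square of
    z^T A x, a sum over the support of x, and Cauchy-Schwarz separates x from the
    coefficients a_i^T z. *)
Lemma penalized_le_energy A rho x z : 0 < rho -> (x^T *m x) 0 0 = 1 ->
  (z^T *m z) 0 0 = 1 ->
  (forall y, (y^T *m y) 0 0 = 1 ->
    thresholded_energy A rho y <= thresholded_energy A rho z) ->
  (x^T *m (A^T *m A) *m x) 0 0 - rho * (Card x)%:R <= thresholded_energy A rho z.
Proof.
move=> rho0 x1 z1 zmax.
have g0 y : 0 <= thresholded_energy A rho y.
  by rewrite sumr_ge0// => i _; rewrite le_max lexx orbT.
rewrite energyE.
have [Ax0|Ax0] := eqVneq (A *m x) 0.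
  rewrite Ax0 mulmx0 mxE sub0r; apply: le_trans (g0 z).
  by rewrite oppr_le0 mulr_ge0 ?(ltW rho0).
have q0 := dot_gt0 Ax0; set q := (_ *m (A *m x)) 0 0 in q0 *.
apply: le_trans (zmax _ (normalize_unit Ax0)).
pose b := A^T *m (A *m x); pose p i := x i 0 != 0.
have yE i : ((col i A)^T *m normalize (A *m x)) 0 0 ^+ 2 = b i 0 ^+ 2 / q.
  by rewrite col_dotE -scalemxAr mxE exprMn normalize_coefE// mulrC.
have qE : q = (x^T *m mask p b) 0 0.
  rewrite /q trmx_mul -mulmxA -/b !mxE; apply: eq_bigr => i _; rewrite !mxE.
  by rewrite /p; case: eqP => //= ->; rewrite !mul0r.
have qle : q ^+ 2 <= \sum_(i | p i) b i 0 ^+ 2.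
  by rewrite {1}qE -mask_sqr -[leRHS]mul1r -x1; exact: cauchy_schwarz.
rewrite cardE; apply: (@le_trans _ _ (\sum_(i | p i) (b i 0 ^+ 2 / q - rho))).
  by rewrite sumrB lerB// -mulr_suml ler_pdivlMr.
rewrite big_mkcond /=; apply: ler_sum => i _.
by case: ifP => _; rewrite le_max ?yE lexx ?orbT.
Qed.

(** Conversely, x is taken proportional to the vector of the a_i^T z whose square
    exceeds rho; the sum of these squares is then (z^T A x)^2, which is at most
    |A x|^2 = x^T Sigma x. *)
Lemma energy_le_penalized A rho z : 0 < rho -> (z^T *m z) 0 0 = 1 ->
  0 < thresholded_energy A rho z ->
  exists2 x, (x^T *m x) 0 0 = 1 & thresholded_energy A rho z <=
    (x^T *m (A^T *m A) *m x) 0 0 - rho * (Card x)%:R.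
Proof.
move=> rho0 z1 gz0.
pose b := A^T *m z; pose p i := rho < b i 0 ^+ 2.
pose v := mask p b; pose N := \sum_(i | p i) b i 0 ^+ 2.
have gE : thresholded_energy A rho z = \sum_(i | p i) (b i 0 ^+ 2 - rho).
  rewrite [RHS]big_mkcond; apply: eq_bigr => i _; rewrite col_dotE -/b /p.
  rewrite -subr_gt0; case: ltP => //.
have N0 : 0 < N.
  apply: lt_le_trans gz0 _; rewrite gE /N; apply: ler_sum => i _.
  by rewrite lerBlDr lerDl ltW.
have vN : (v^T *m v) 0 0 = N by exact: mask_sqr.
have v0 : v != 0.
  by apply/eqP => v0; move: N0; rewrite -vN v0 mulmx0 mxE ltxx.
pose k := (Num.sqrt ((v^T *m v) 0 0))^-1.
have k0 : 0 < k by rewrite invr_gt0 sqrtr_gt0 vN.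
exists (normalize v); first exact: normalize_unit.
rewrite cardE (eq_bigl p); last first.
  move=> i; rewrite /normalize -/k mxE [v i 0]mxE mulf_eq0 (gt_eqF k0) /=.
  case: ifP => pi; last by rewrite eqxx.
  by rewrite -sqrf_eq0 gt_eqF// (lt_trans rho0 pi).
rewrite gE sumrB lerD2r -/N quadratic_formZ normalize_coefE// vN energyE.
rewrite -[leLHS](mulKf (lt0r_neq0 N0)).
have zAv : (z^T *m (A *m v)) 0 0 = N.
  rewrite mulmxA -[z^T *m A]trmxK trmx_mul trmxK -/b mxE /N [RHS]big_mkcond.
  apply: eq_bigr => i _; rewrite [_^T _ _]mxE [v i 0]mxE.
  by case: ifP => _; rewrite ?mulr0// expr2.
rewrite ler_pM2l ?invr_gt0// -expr2 -{1}zAv.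
by have := cauchy_schwarz z (A *m v); rewrite z1 mul1r.
Qed.

(** The bound rho < Sigma i i makes the maximum positive, so that the support in
    the previous lemma is nonempty. *)
Lemma phi_eq_max Sigma A rho : Sigma = A^T *m A -> 0 < rho ->
  (forall i, rho < Sigma i i) ->
  exists2 c, (c^T *m c) 0 0 = 1 & phi Sigma rho = thresholded_energy A rho c /\
    forall z, (z^T *m z) 0 0 = 1 -> thresholded_energy A rho z <= phi Sigma rho.
Proof.
move=> -> rho0 hrho; have [c c1 cmax] := thresholded_energy_max A rho.
exists c => //; suff -> : phi (A^T *m A) rho = thresholded_energy A rho c by [].
have ub x : (x^T *m x) 0 0 = 1 -> (x^T *m (A^T *m A) *m x) 0 0 - rho * (Card x)%:R
    <= thresholded_energy A rho c.
  by move=> x1; exact: penalized_le_energy.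
have gc0 : 0 < thresholded_energy A rho c.
  apply: lt_le_trans (ub _ (delta_unit 0)).
  have -> : Card (delta_mx 0 0 : 'cV[R]_n.+1) = 1%N.
    rewrite /Card (_ : [set i | _]%SET = [set 0]%SET) ?cards1//.
    apply/finset.setP => i; rewrite !inE mxE eqxx andbT.
    by case: (i == 0); rewrite ?oner_eq0 ?eqxx.
  by rewrite mulr1 subr_gt0 delta_formE.
have [x x1 xge] := energy_le_penalized rho0 c1 gc0.
apply: max_ofE; last by move=> _ [y /norm2_eq1 y1 <-]; exact: ub.
exists x; first exact/norm2_eq1.
by apply/eqP; rewrite eq_le xge ub.
Qed.

(** The bound extends to all vectors, both sides being homogeneous of degree 2. *)
Lemma thresholded_energy_homogeneous A rho (M : R) y :
  (forall z, (z^T *m z) 0 0 = 1 -> thresholded_energy A rho z <= M) ->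
  \sum_i Num.max (((col i A)^T *m y) 0 0 ^+ 2 - rho * (y^T *m y) 0 0) 0 <=
  M * (y^T *m y) 0 0.
Proof.
move=> hM; have [->|y0] := eqVneq y 0.
  rewrite mulmx0 mxE !mulr0 big1// => i _.
  by rewrite mulmx0 mxE expr0n subrr maxxx.
have q0 := dot_gt0 y0.
rewrite -ler_pdivrMr// mulr_suml; apply: le_trans (hM _ (normalize_unit y0)).
apply: ler_sum => i _; rewrite maxr_pMl ?invr_ge0 ?(ltW q0)// mul0r.
have -> : ((col i A)^T *m normalize y) 0 0 =
    (Num.sqrt ((y^T *m y) 0 0))^-1 * ((col i A)^T *m y) 0 0.
  by rewrite -scalemxAr mxE.
by rewrite exprMn normalize_coefE// mulrBl mulfK ?gt_eqF// mulrC.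
Qed.

End cardinality_penalty.

(** * Plane rotations and the Gaussian measure *)

Section lebesgue_invariance.
Context {R : realType}.
Local Notation mu := (@lebesgue_measure R).
Local Notation RT := (measurableTypeR R).

Lemma lebesgue_measure_shift (a : R) (A : set R) : measurable A ->
  pushforward mu (fun x : RT => x + a : RT) A = mu A.
Proof.
move=> mA; apply/esym; pose f : RT -> RT := fun x => x + a.
have mf : measurable_fun setT f by apply: measurable_funD.
apply: (lebesgue_measure_unique (mu := pushforward mu f)) => //= _ [[b c]] _ <-.
rewrite /pushforward /=.
have -> : f @^-1` `]b, c] = `]b - a, c - a]%classic.
  by apply/seteqP; split => x /=; rewrite !in_itv/= ltrBlDr lerBrDr.
rewrite !lebesgue_measure_itv/= !lte_fin ltrD2r.
by case: ifP => // _; congr (_%:E); ring.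
Qed.

Lemma ge0_integral_shift (a : R) (f : R -> \bar R) :
  measurable_fun setT f -> (forall x, 0 <= f x)%E ->
  (\int[mu]_x f (x + a)%R = \int[mu]_x f x)%E.
Proof.
move=> mf f0; pose g : RT -> RT := fun x => x + a.
have mg : measurable_fun setT g by apply: measurable_funD.
rewrite -[LHS](@ge0_integral_pushforward _ _ _ _ _ g mg mu setT f)//.
by apply: eq_measure_integral => //= A mA _; exact: lebesgue_measure_shift.
Qed.

Lemma ge0_integral_opp (f : R -> \bar R) :
  measurable_fun setT f -> (forall x, 0 <= f x)%E ->
  (\int[mu]_x f (- x)%R = \int[mu]_x f x)%E.
Proof.
move=> mf f0; pose g : RT -> RT := fun x => - x.
have mg : measurable_fun setT g by apply: measurable_funN.
rewrite -[LHS](@ge0_integral_pushforward _ _ _ _ _ g mg mu setT f)//.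
by apply: eq_measure_integral => //= A mA _; exact: lebesgue_measureN.
Qed.

Definition plane_integral (F : RT * RT -> \bar R) : \bar R :=
  (\int[mu]_x \int[mu]_y F (x, y))%E.

Let measurable_section (F : RT * RT -> \bar R) (x : R) :
  measurable_fun setT F -> measurable_fun setT (fun y : RT => F (x, y)).
Proof. by move=> mF; apply: (measurable_fun_pair2 x mF). Qed.

Lemma plane_integral_sheary (s : R) F :
  measurable_fun setT F -> (forall p, 0 <= F p)%E ->
  plane_integral (fun p => F (p.1, p.2 + s * p.1)) = plane_integral F.
Proof.
move=> mF F0; apply: eq_integral => x _ /=.
by rewrite (ge0_integral_shift _ (f := fun y => F (x, y)))//; exact: measurable_section.
Qed.

Lemma plane_integral_flipy F :
  measurable_fun setT F -> (forall p, 0 <= F p)%E ->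
  plane_integral (fun p => F (p.1, - p.2)) = plane_integral F.
Proof.
move=> mF F0; apply: eq_integral => x _ /=.
by rewrite (ge0_integral_opp (f := fun y => F (x, y)))//; exact: measurable_section.
Qed.

Lemma plane_integral_swap F :
  measurable_fun setT F -> (forall p, 0 <= F p)%E ->
  plane_integral (fun p => F (p.2, p.1)) = plane_integral F.
Proof. by move=> mF F0; rewrite /plane_integral [RHS](fubini_tonelli F). Qed.

Let mfun2 (g h : RT * RT -> RT) (F : RT * RT -> \bar R) :
  measurable_fun setT g -> measurable_fun setT h -> measurable_fun setT F ->
  measurable_fun setT (fun p => F (g p, h p)).
Proof.
by move=> mg mh mF; apply: (measurableT_comp mF); exact: measurable_fun_pair.
Qed.

Lemma plane_integral_shearx (s : R) F :
  measurable_fun setT F -> (forall p, 0 <= F p)%E ->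
  plane_integral (fun p => F (p.1 + s * p.2, p.2)) = plane_integral F.
Proof.
move=> mF F0.
have mF' : measurable_fun setT (fun p : RT * RT => F (p.2, p.1)).
  exact: mfun2.
etransitivity; last exact: (plane_integral_swap mF F0).
etransitivity; last exact: (plane_integral_sheary s mF').
apply/esym; apply: (plane_integral_swap (F := fun p => F (p.1 + s * p.2, p.2))).
  by apply: mfun2 => //; apply: measurable_funD => //; exact: measurable_funM.
by move=> p; exact: F0.
Qed.

(** A rotation with s != 0 is the composition of three shears, and the shears
    preserve the integral by Fubini and translation invariance; a reflection is a
    rotation after the sign change of the second coordinate. *)
Lemma plane_integral_reflection (c s : R) F : c ^+ 2 + s ^+ 2 = 1 ->
  measurable_fun setT F -> (forall p, 0 <= F p)%E ->
  plane_integral (fun p => F (c * p.1 + s * p.2, s * p.1 - c * p.2)) =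
  plane_integral F.
Proof.
move=> cs1 mF F0.
have maff (a b : R) : measurable_fun setT
    (fun p : RT * RT => a * p.1 + b * p.2 : RT).
  by apply: measurable_funD; exact: measurable_funM.
have mlin (a b a' b' : R) : measurable_fun setT
    (fun p : RT * RT => F (a * p.1 + b * p.2, a' * p.1 + b' * p.2)).
  exact: mfun2.
have [s0|s0] := eqVneq s 0.
  have : (c - 1) * (c + 1) = 0 by rewrite -subr_sqr expr1n -cs1 s0; ring.
  move/eqP; rewrite mulf_eq0 subr_eq0 addr_eq0 s0 => /orP[]/eqP ->.
    etransitivity; last exact: (plane_integral_flipy mF F0).
    by congr plane_integral; apply/funext => p /=; congr (F (_, _)); ring.
  have mF1 : measurable_fun setT (fun p : RT * RT => F (p.2, p.1)).
    exact: mfun2.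
  have mF2 : measurable_fun setT (fun p : RT * RT => F (- p.2, p.1)).
    by apply: mfun2 => //; apply: measurable_funN.
  etransitivity; last exact: (plane_integral_swap mF F0).
  etransitivity; last exact: (plane_integral_flipy mF1).
  etransitivity; last exact: (plane_integral_swap mF2).
  by congr plane_integral; apply/funext => p /=; congr (F (_, _)); ring.
(* t is the tangent of half the angle of the rotation. *)
pose t := (1 - c) / s.
have mF1 : measurable_fun setT (fun p : RT * RT => F (p.1 + - t * p.2, p.2)).
  have := mlin 1 (- t) 0 1; congr (measurable_fun _ _).
  by apply/funext => p /=; congr (F (_, _)); ring.
have mF2 : measurable_fun setT
    (fun p : RT * RT => F (p.1 + - t * (p.2 + s * p.1), p.2 + s * p.1)).
  have := mlin (1 - t * s) (- t) s 1; congr (measurable_fun _ _).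
  by apply/funext => p /=; congr (F (_, _)); ring.
have mF3 : measurable_fun setT
    (fun p : RT * RT => F (p.1 + - t * p.2 + - t * (p.2 + s * (p.1 + - t * p.2)),
                           p.2 + s * (p.1 + - t * p.2))).
  have := mlin (1 - t * s) (- t - t * (1 - t * s)) s (1 - t * s).
  congr (measurable_fun _ _).
  by apply/funext => p /=; congr (F (_, _)); ring.
etransitivity; last exact: (plane_integral_shearx (- t) mF F0).
etransitivity; last exact: (plane_integral_sheary s mF1).
etransitivity; last exact: (plane_integral_shearx (- t) mF2).
etransitivity; last exact: (plane_integral_flipy mF3).
have ts : t * s = 1 - c by rewrite /t mulfVK.
have tc : t * (1 + c) = s.
  apply: (mulIf s0); rewrite mulrAC ts -expr2.
  by transitivity (1 - c ^+ 2); [ring|rewrite -cs1; ring].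
have tE : t + t * (1 - t * s) = s by rewrite ts -[RHS]tc; ring.
congr plane_integral; apply/funext => p /=; congr (F (_, _)).
  transitivity ((1 - t * s) * p.1 + (t + t * (1 - t * s)) * p.2); last by ring.
  by rewrite tE ts; ring.
transitivity (s * p.1 - (1 - t * s) * p.2); last by ring.
by rewrite ts; ring.
Qed.

End lebesgue_invariance.

Section standard_normal_law.
Context {R : realType}.
Local Notation mu := (@lebesgue_measure R).
Local Notation RT := (measurableTypeR R).
Local Notation gamma := (@normal_prob R 0 1).
Local Notation pdf := (@normal_pdf R 0 1).

Lemma ge0_integral_normal_prob (f : RT -> \bar R) :
  measurable_fun setT f -> (forall x, 0 <= f x)%E ->
  (\int[gamma]_x f x = \int[mu]_x (f x * (pdf x)%:E))%E.
Proof.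
move=> mf f0; have dom := @normal_prob_dominates R 0 1.
rewrite -(Radon_Nikodym_SigmaFinite.change_of_variables dom)//.
have mg := measurable_int _ (Radon_Nikodym_SigmaFinite.f_integrable dom).
apply: ae_eq_integral => //.
- exact: emeasurable_funM.
- apply: emeasurable_funM => //; apply/measurable_EFinP.
  exact: measurable_normal_pdf.
- apply: ae_eqe_mul2l; apply: integral_ae_eq => //.
  + exact: Radon_Nikodym_SigmaFinite.f_integrable.
  + by apply/measurable_EFinP; exact: measurable_normal_pdf.
  + by move=> E _ mE; rewrite -Radon_Nikodym_SigmaFinite.f_integral.
Qed.

Lemma normal_pdf01E (x : R) : pdf x = normal_peak 1 * expR (- (x ^+ 2 / 2)).
Proof.
rewrite /normal_pdf oner_eq0 /normal_fun; congr (_ * expR _).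
by rewrite expr1n subr0; lra.
Qed.

(** The density of the product depends on x^2 + y^2 only. *)
Lemma normal_prod_reflection (c s : R) (C : set (RT * RT)) :
  c ^+ 2 + s ^+ 2 = 1 -> measurable C ->
  (gamma \x gamma)%E ((fun p : RT * RT => (c * p.1 + s * p.2 : RT,
     s * p.1 - c * p.2 : RT)) @^-1` C) = (gamma \x gamma)%E C.
Proof.
move=> cs1 mC.
set rho := fun p : RT * RT => _.
have mrho : measurable_fun setT rho.
  apply: measurable_fun_pair.
    by apply: measurable_funD; exact: measurable_funM.
  by apply: measurable_funB; exact: measurable_funM.
have densE (D : set (RT * RT)) : measurable D ->
    (gamma \x gamma)%E D = plane_integral
     (fun p => (\1_D p *
        (normal_peak 1 ^+ 2 * expR (- ((p.1 ^+ 2 + p.2 ^+ 2) / 2))))%:E).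
  move=> mD.
  have mI (x : R) : measurable_fun setT (fun y : RT => (\1_D (x, y) : R)%:E).
    apply/measurable_EFinP.
    apply: (measurable_fun_pair2 (f := (\1_D : RT * RT -> R)) x).
    exact: measurable_indic.
  have mpdf : measurable_fun setT (fun x : RT => (pdf x)%:E).
    by apply/measurable_EFinP; exact: measurable_normal_pdf.
  transitivity (\int[(gamma \x gamma)%E]_p (\1_D p)%:E)%E.
    by rewrite (integral_indic _ _ mD) ?setIT.
  have mD1 : measurable_fun setT (fun p : RT * RT => (\1_D p : R)%:E).
    by apply/measurable_EFinP; exact: measurable_indic.
  have D0 (p : RT * RT) : (0 <= (\1_D p : R)%:E)%E by rewrite lee_fin.
  rewrite (fubini_tonelli1 _ mD1 D0).
  rewrite /fubini_F ge0_integral_normal_prob; first last.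
  - by move=> x; apply: integral_ge0 => y _; rewrite lee_fin.
  - exact: (measurable_fun_fubini_tonelli_F _ mD1 D0).
  apply: eq_integral => x _; rewrite ge0_integral_normal_prob//.
  rewrite muleC -ge0_integralZl//; first last.
  - by rewrite lee_fin normal_pdf_ge0.
  - by move=> y _; rewrite mule_ge0// lee_fin// normal_pdf_ge0.
  - exact: emeasurable_funM.
  apply: eq_integral => y _; rewrite /= -!EFinM !normal_pdf01E; congr (_%:E).
  have -> : - ((x ^+ 2 + y ^+ 2) / 2) = - (x ^+ 2 / 2) + - (y ^+ 2 / 2) by lra.
  by rewrite expRD; ring.
have mpre : measurable (rho @^-1` C) by rewrite -[_ @^-1` _]setTI; exact: mrho.
etransitivity; first exact: (densE _ mpre).
etransitivity; last exact: (esym (densE _ mC)).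
etransitivity; last apply: (plane_integral_reflection cs1).
- congr plane_integral; apply/funext => -[x y] /=.
  rewrite (_ : (c * x + s * y) ^+ 2 + (s * x - c * y) ^+ 2 =
               (c ^+ 2 + s ^+ 2) * (x ^+ 2 + y ^+ 2)); last by ring.
  by rewrite cs1 mul1r !indicE.
- apply/measurable_EFinP; apply: measurable_funM; first exact: measurable_indic.
  apply: measurable_funM => //; apply: measurableT_comp => //.
  apply: measurable_funN; apply: measurable_funM => //.
  by apply: measurable_funD; apply: measurable_funX.
- move=> p.
  by rewrite lee_fin !mulr_ge0 ?expR_ge0 ?normal_peak_ge0.
Qed.

(** The densities of the centered normal laws of deviations 1 and s > 1 satisfy
    s * pdf_s x >= pdf_1 x * (1 + (1 - s^-2) / 2 * x ^+ 2), because
    exp u >= 1 + u. Integrating bounds the second moment I by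
    1 + (1 - s^-2) / 2 * I <= s, and s = sqrt I is impossible if I > 1. *)
Lemma normal_second_moment_le1 : (\int[gamma]_x (x ^+ 2)%:E <= 1)%E.
Proof.
rewrite ge0_integral_normal_prob; last 2 first.
- by apply/measurable_EFinP; exact: measurable_funX.
- by move=> x; rewrite lee_fin sqr_ge0.
under eq_integral do rewrite -EFinM.
set I := (X in (X <= _)%E).
have mpdf (s : R) : measurable_fun setT (fun x : RT => (normal_pdf 0 s x)%:E).
  by apply/measurable_EFinP; exact: measurable_normal_pdf.
have mI : measurable_fun setT (fun x : RT => (x ^+ 2 * pdf x)%:E).
  apply/measurable_EFinP; apply: measurable_funM; first exact: measurable_funX.
  exact: measurable_normal_pdf.
have I0 : (0 <= I)%E.
  by apply: integral_ge0 => x _; rewrite lee_fin mulr_ge0 ?sqr_ge0 ?normal_pdf_ge0.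
have key (s : R) : 1 < s -> (1 + ((1 - s ^- 2) / 2)%:E * I <= s%:E)%E.
  move=> s1; have s0 : 0 < s by lra.
  have k0 : 0 <= (1 - s ^- 2) / 2.
    by rewrite divr_ge0// subr_ge0 invf_le1 ?exprn_gt0// exprn_ege1// ltW.
  have pdf0 (t x : R) : (0 <= (normal_pdf 0 t x)%:E)%E.
    by rewrite lee_fin normal_pdf_ge0.
  have h0 (x : R) : (0 <= (x ^+ 2 * pdf x)%:E)%E.
    by rewrite lee_fin mulr_ge0 ?sqr_ge0 ?normal_pdf_ge0.
  rewrite -[X in (X + _)%E](integral_normal_pdf 0 1) -[X in (_ <= X)%E]mule1.
  rewrite -(integral_normal_pdf 0 s).
  rewrite -(@ge0_integralZl _ _ _ mu setT measurableT _ (mpdf s))//; last first.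
    by rewrite lee_fin ltW.
  rewrite -(@ge0_integralZl _ _ _ mu setT measurableT _ mI)//.
  rewrite -ge0_integralD//; last 2 first.
  - by move=> x _; rewrite mule_ge0.
  - exact: emeasurable_funM.
  apply: ge0_le_integral => //.
  - by move=> x _; rewrite adde_ge0 ?mule_ge0.
  - by apply: emeasurable_funD => //; exact: emeasurable_funM.
  - exact: emeasurable_funM.
  move=> x _; rewrite -!EFinM -EFinD lee_fin normal_pdf01E.
  have peakE : s * normal_peak s = normal_peak 1.
    rewrite /normal_peak expr1n mul1r -mulrnAr sqrtrM ?sqr_ge0//.
    by rewrite sqrtr_sqr gtr0_norm// invfM mulrA divff ?mul1r ?gt_eqF.
  rewrite /normal_pdf gt_eqF// [in leRHS]mulrA peakE /normal_fun subr0.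
  set p := normal_peak 1; have p0 : 0 <= p by exact: normal_peak_ge0.
  have -> : - x ^+ 2 / (s ^+ 2 *+ 2) = - (x ^+ 2 / 2) + (1 - s ^- 2) / 2 * x ^+ 2.
    by field; rewrite gt_eqF.
  rewrite expRD; set e := expR (- (_ / _)).
  have e0 : 0 <= e by rewrite expR_ge0.
  rewrite [leLHS](_ : _ = p * e * (1 + (1 - s ^- 2) / 2 * x ^+ 2)); last by ring.
  by rewrite [leRHS]mulrA ler_wpM2l ?mulr_ge0// expR_ge1Dx.
case: I I0 key => [I _ key|_ key|//]; last first.
  have : (1 < (2 : R)) by lra.
  move/key; rewrite gt0_muley ?lte_fin; last by rewrite divr_gt0//; lra.
  by rewrite addey// leye_eq.
rewrite lee_fin leNgt; apply/negP => I1.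
pose s := Num.sqrt I.
have sI : s ^+ 2 = I by rewrite sqr_sqrtr// ltW// (lt_trans ltr01).
have s1 : 1 < s by rewrite -[ltLHS]sqrtr1 ltr_sqrt// (lt_trans ltr01).
have s0 : s != 0 by rewrite gt_eqF// (lt_trans ltr01).
have := key s s1; rewrite -EFinM -EFinD lee_fin -sI => h.
have : 1 + (s ^+ 2 - 1) / 2 <= s.
  by rewrite (_ : _ / 2 = (1 - s ^- 2) / 2 * s ^+ 2)//; field.
by nra.
Qed.

End standard_normal_law.

(** * Standard Gaussian vectors *)

Section gaussian_vectors.
Context {R : realType} {d : measure_display} {T : measurableType d}.
Context {P : probability T R}.
Local Notation RT := (measurableTypeR R).
Local Notation gamma := (@normal_prob R 0 1).

(** Independence is required for the full family only: taking some of the sets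
    equal to [setT] gives the subfamilies. *)
Definition standard_gaussian {r} (Z : T -> 'cV[R]_r) : Prop :=
  (forall i, measurable_fun setT (fun t => Z t i 0 : RT)) /\
  forall B : 'I_r -> set RT, (forall i, measurable (B i)) ->
    P [set t | forall i, B i (Z t i 0)] = (\prod_i gamma (B i))%E.

(** Measurability for the sigma-algebra generated by the coordinates, borrowed
    from tuples. *)
Definition tuple_measurable {d'} {U : measurableType d'} {r}
    (f : 'cV[R]_r -> U) : Prop :=
  measurable_fun setT (fun x : r.-tuple RT => f (\col_i tnth x i)).

Lemma tuple_measurable_coord r (i : 'I_r) :
  tuple_measurable (fun z : 'cV[R]_r => z i 0 : RT).
Proof.
rewrite /tuple_measurable (_ : (fun x => _) = (@tnth _ _)^~ i).
  exact: measurable_tnth.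
by apply/funext => x; rewrite mxE.
Qed.

Let toT {r} (Z : T -> 'cV[R]_r) (t : T) : r.-tuple RT := [tuple Z t i 0 | i < r].

Let mtoT {r} (Z : T -> 'cV[R]_r) : standard_gaussian Z ->
  measurable_fun setT (toT Z).
Proof.
move=> [mZ _]; apply/measurable_fun_tnthP => i.
rewrite [X in measurable_fun _ X](_ : _ = fun t => Z t i 0); first exact: mZ.
by apply/funext => t; rewrite /= tnth_mktuple.
Qed.

Let coltoT {r} (Z : T -> 'cV[R]_r) t : \col_i tnth (toT Z t) i = Z t.
Proof. by apply/colP => i; rewrite mxE tnth_mktuple. Qed.

Lemma tuple_measurable_comp d' (U : measurableType d') r (f : 'cV[R]_r -> U)
    (Z : T -> 'cV[R]_r) : standard_gaussian Z -> tuple_measurable f ->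
  measurable_fun setT (fun t => f (Z t)).
Proof.
move=> gZ mf; have := measurableT_comp mf (mtoT gZ); congr measurable_fun.
by apply/funext => t /=; rewrite coltoT.
Qed.

(** The boxes form a pi-system generating the sigma-algebra. *)
Let standard_gaussian_law {r} (Z Z' : T -> 'cV[R]_r) :
  standard_gaussian Z -> standard_gaussian Z' ->
  forall A : set (r.-tuple RT), measurable A ->
    P (toT Z @^-1` A) = P (toT Z' @^-1` A).
Proof.
move=> gZ gZ' A mA.
pose G := [set [set x : r.-tuple RT | forall i, B i (tnth x i)] |
            B in [set B : 'I_r -> set RT | forall i, measurable (B i)]].
have mG : G `<=` measurable.
  move=> _ [B mB <-].
  rewrite (_ : mkset _ =
      \bigcap_(i in [set: 'I_r]) ((@tnth _ _)^~ i @^-1` B i)).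
    apply: fin_bigcap_measurable => // i _.
    rewrite -[X in measurable X]setTI; exact: measurable_tnth.
  by apply/seteqP; split => x xB i *; exact: xB.
have sG : <<s G >> A.
  move: A mA; apply: smallest_sub; first exact: smallest_sigma_algebra.
  apply: (@big_ind _ (fun C => C `<=` <<s G >>)) => //.
  - by move=> C D CG DG x [/CG|/DG].
  move=> i _ _ [C mC <-]; apply: sub_sigma_algebra.
  exists (fun j => if j == i then C else setT).
    by move=> j /=; case: ifP.
  rewrite setTI; apply/seteqP; split => x /=.
    by move=> /(_ i); rewrite eqxx.
  by move=> xC j; case: eqP => // ->.
pose m1 : {measure set (r.-tuple RT) -> \bar R} := pushforward P (toT Z).
pose m2 : {measure set (r.-tuple RT) -> \bar R} := pushforward P (toT Z').
have := @g_sigma_algebra_measure_unique _ R _ G mG (fun=> setT) _ _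
  (m1 (mtoT gZ)) (m2 (mtoT gZ')) _ _ _ A sG.
apply.
- move=> _; exists (fun=> setT) => //.
  by apply/seteqP; split.
- by rewrite bigcup_const //; exists 0%N.
- move=> _ _ [B mB <-] [C mC <-]; exists (fun i => B i `&` C i).
    by move=> i; exact: measurableI.
  apply/seteqP; split => x /=.
    by move=> h; split=> i; have [] := h i.
  by move=> [h1 h2] i; split.
- move=> _ [B mB <-]; rewrite /m1 /m2 /pushforward /=.
  transitivity (P [set t | forall i, B i (Z t i 0)]).
    congr (P _); apply/seteqP; split => t /= h i; have := h i;
      by rewrite tnth_mktuple.
  rewrite (proj2 gZ)// -(proj2 gZ')//.
  congr (P _); apply/seteqP; split => t /= h i; have := h i;
    by rewrite tnth_mktuple.
- by move=> _; rewrite (_ : (_ < _)%E = (P setT < +oo)%E)// probability_setT ltry.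
Qed.

Lemma standard_gaussian_integral {r} (Z Z' : T -> 'cV[R]_r)
    (f : 'cV[R]_r -> \bar R) :
  standard_gaussian Z -> standard_gaussian Z' -> tuple_measurable f ->
  (\int[P]_t f (Z t) = \int[P]_t f (Z' t))%E.
Proof.
move=> gZ gZ' mf.
suff ge0 (g : 'cV[R]_r -> \bar R) :
    tuple_measurable g -> (forall z, 0 <= g z)%E ->
    (\int[P]_t g (Z t) = \int[P]_t g (Z' t))%E.
  have posE (U : Type) (Y : U -> 'cV[R]_r) :
      ((fun t => f (Y t))^\+ = (fun t => f^\+ (Y t)))%E.
    by apply/funext => t; rewrite !funeposE.
  have negE (U : Type) (Y : U -> 'cV[R]_r) :
      ((fun t => f (Y t))^\- = (fun t => f^\- (Y t)))%E.
    by apply/funext => t; rewrite !funenegE.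
  rewrite integralE [RHS]integralE.
  rewrite (posE _ Z) (posE _ Z') (negE _ Z) (negE _ Z'); congr (_ - _)%E.
    apply: (ge0 (f^\+)%E) => [|z]; last exact: funepos_ge0.
    by rewrite /tuple_measurable -posE; exact: measurable_funepos.
  apply: (ge0 (f^\-)%E) => [|z]; last exact: funeneg_ge0.
  by rewrite /tuple_measurable -negE; exact: measurable_funeneg.
move=> mg g0.
pose h (x : r.-tuple RT) := g (\col_i tnth x i).
have push (Y : T -> 'cV[R]_r) : standard_gaussian Y ->
    (\int[P]_t g (Y t) = \int[pushforward P (toT Y)]_x h x)%E.
  move=> gY; rewrite (ge0_integral_pushforward (mtoT gY))//; last first.
    by move=> x _; exact: g0.
  by apply: eq_integral => t _; rewrite /h /= coltoT.
rewrite (push _ gZ) (push _ gZ').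
apply: eq_measure_integral => [||? ? D mD _]; [exact: mtoT|exact: mtoT|].
exact: standard_gaussian_law.
Qed.

(** The event F fixes the coordinates other than i and j. On F, the pair of
    coordinates i and j has the law P(F) times the product of two normal laws,
    and this product is invariant under plane reflections. *)
Lemma standard_gaussian_reflection {r} (Z : T -> 'cV[R]_r) (i j : 'I_r) c s :
  standard_gaussian Z -> i != j -> c ^+ 2 + s ^+ 2 = 1 ->
  standard_gaussian (fun t => reflection i j c s *m Z t).
Proof.
move=> [mZ gZ] ij cs1.
have ji : (j == i) = false by rewrite eq_sym (negPf ij).
split=> [k|B mB].
  rewrite (_ : (fun t => _) = fun t => if k == i then c * Z t i 0 + s * Z t j 0
      else if k == j then s * Z t i 0 - c * Z t j 0 else Z t k 0); last first.
    by apply/funext => t; rewrite reflectionE.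
  case: (k == i); last case: (k == j); last exact: mZ.
    by apply: measurable_funD; apply: measurable_funM => //; exact: mZ.
  by apply: measurable_funB; apply: measurable_funM => //; exact: mZ.
pose rho (p : RT * RT) : RT * RT := (c * p.1 + s * p.2, s * p.1 - c * p.2).
pose F := [set t | forall k, k != i -> k != j -> B k (Z t k 0)].
pose kappa := (\prod_(k | (k != i) && (k != j)) gamma (B k))%E.
pose C := B i `*` B j.
have mC : measurable C by exact: measurableX.
have prodE (D : 'I_r -> set RT) (A1 A2 : set RT) : D i = A1 -> D j = A2 ->
    (forall k, k != i -> k != j -> D k = B k) ->
    (\prod_k gamma (D k) = kappa * (gamma A1 * gamma A2))%E.
  move=> Di Dj Dk; rewrite (bigD1 i)//= (bigD1 j)/=; last by rewrite ji.
  rewrite Di Dj muleA muleC; congr (_ * _)%E.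
  by apply: eq_bigr => k /andP[ki kj]; rewrite Dk.
pose pair t : RT * RT := (Z t i 0, Z t j 0).
have mpair : measurable_fun setT pair by apply: measurable_fun_pair; exact: mZ.
have mF : measurable F.
  rewrite (_ : F = \bigcap_(k in [set k | (k != i) && (k != j)])
      ((fun t => Z t k 0 : RT) @^-1` B k)).
    apply: fin_bigcap_measurable => [|k _]; first exact: finite_finset.
    by rewrite -[X in measurable X]setTI; exact: mZ.
  apply/seteqP; split => t /=; first by move=> h k /= /andP[ki kj]; exact: h.
  by move=> h k ki kj; apply: h; rewrite /= ki kj.
have FE (A1 A2 : set RT) : measurable A1 -> measurable A2 ->
    P (F `&` pair @^-1` (A1 `*` A2)) = (kappa * (gamma A1 * gamma A2))%E.
  move=> mA1 mA2.
  pose D k := if k == i then A1 else if k == j then A2 else B k.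
  rewrite -(@prodE D A1 A2) /D ?eqxx ?ji//; last first.
    by move=> k /negPf -> /negPf ->.
  rewrite -gZ; last by move=> k; case: ifP => // _; case: ifP.
  congr (P _); apply/seteqP; split => t /=.
    move=> [Ft [tA1 tA2]] k; have [->//|ki] := eqVneq k i.
    by have [->//|kj] := eqVneq k j; exact: Ft.
  move=> h; split; last by split; [have := h i|have := h j]; rewrite ?eqxx ?ji.
  by move=> k /negPf ki /negPf kj; have := h k; rewrite ki kj.
have kappaE : kappa = P F.
  have := FE setT setT measurableT measurableT.
  by rewrite setXTT preimage_setT setIT !probability_setT !mule1 => ->.
have k0 : 0 <= fine kappa by rewrite fine_ge0// kappaE.
pose kn : {nonneg R} := NngNum k0.
have kfin : ((fine kappa)%:E = kappa)%E.
  by rewrite fineK// kappaE fin_num_measure.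
pose m' : {measure set (RT * RT) -> \bar R} := pushforward (mrestr P mF) pair.
pose m2 : {measure set (RT * RT) -> \bar R} := mscale kn (gamma \x gamma)%E.
have FprodE (D : set (RT * RT)) : measurable D ->
    P (F `&` pair @^-1` D) = (kappa * (gamma \x gamma)%E D)%E.
  move=> mD.
  have unique := @product_measure_unique _ _ _ _ R (mscale kn gamma) gamma.
  have e1 := unique (m' mpair) _ D mD; have e2 := unique m2 _ D mD.
  transitivity (m' mpair D).
    by rewrite /m' /= /pushforward /mrestr setIC.
  rewrite -e1; last first.
    move=> A1 A2 mA1 mA2; rewrite /m' /= /pushforward /mrestr setIC FE//.
    by rewrite /mscale /= kfin muleA.
  rewrite e2; last first.
    move=> A1 A2 mA1 mA2; rewrite /m2 /= /mscale /= kfin.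
    by rewrite -muleA product_measure1E.
  by rewrite /m2 /= /mscale /= kfin.
rewrite (@prodE B (B i) (B j))// -product_measure1E//.
rewrite -(normal_prod_reflection cs1 mC) -FprodE; last first.
  rewrite -[X in measurable X]setTI.
  have mrho : measurable_fun setT rho.
    apply: measurable_fun_pair.
      by apply: measurable_funD; exact: measurable_funM.
    by apply: measurable_funB; exact: measurable_funM.
  exact: mrho.
congr (P _); apply/seteqP; split => t /= h.
  split; last first.
    by split; [have := h i|have := h j]; rewrite reflectionE ?eqxx ?ji.
  by move=> k /negPf ki /negPf kj; have := h k; rewrite reflectionE ki kj.
move: h => [Ft [ti tj]] k; rewrite reflectionE.
have [->//|ki] := eqVneq k i; have [->//|kj] := eqVneq k j; exact: Ft.
Qed.

Lemma standard_gaussian_reflection_product {r} (Z : T -> 'cV[R]_r) Q :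
  standard_gaussian Z -> reflection_product Q ->
  standard_gaussian (fun t => Q *m Z t).
Proof.
move=> gZ; elim=> [|i j c s {}Q ij cs1 _ gQ].
  by under eq_fun do rewrite mul1mx.
under eq_fun do rewrite -mulmxA.
exact: standard_gaussian_reflection.
Qed.

End gaussian_vectors.
Arguments standard_gaussian {R d T} P {r} Z.

Lemma independent_normal_standard_gaussian (R : realType) (d : measure_display)
    (T : measurableType d) (P : probability T R) (xi : nat -> {RV P >-> R}) m :
  mutually_independent [set i : nat | (1 <= i <= m.+1)%N] xi ->
  (forall i : nat, (1 <= i <= m.+1)%N -> standard_normal (xi i)) ->
  standard_gaussian P (fun t => \col_(i < m.+1) xi i.+1 t).
Proof.
move=> hindep hnormal; split=> [i|B mB].
  rewrite (_ : (fun t => _) = xi i.+1); first exact: (measurable_funP (xi i.+1)).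
  by apply/funext => t; rewrite mxE.
pose J : {fset nat} := [fset k in iota 1 m.+1]%fset.
have JE k : (k \in J) = (1 <= k <= m.+1)%N.
  transitivity (k \in iota 1 m.+1); last by rewrite mem_iota.
  by apply/imfsetP/idP => [[l lJ ->]//|kJ]; exists k.
pose B' k : set R := B (inord k.-1).
have mB' k : measurable (B' k) by exact: mB.
have B'S (i : 'I_m.+1) : B' i.+1 = B i by rewrite /B' /= inord_val.
have := hindep J B' _ mB'.
rewrite (_ : \bigcap_(_ in _) _ =
    [set t | forall i, B i ((\col_(i < m.+1) xi i.+1 t) i 0)]).
  move=> ->; last by move=> k; rewrite /= JE.
  rewrite (perm_big (iota 1 m.+1)); last first.
    apply: uniq_perm; [exact: fset_uniq|exact: iota_uniq|].
    by move=> k; rewrite JE mem_iota add1n ltnS.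
  rewrite -[iota 1 m.+1]/(index_iota 1 m.+2) big_add1 big_mkord.
  apply: eq_bigr => i _; rewrite B'S.
  exact: (hnormal i.+1 (ltn_ord i) _ (mB i)).
apply/seteqP; split => t /= h.
  move=> i; rewrite mxE -B'S; apply: h => /=.
  by rewrite JE /= ltn_ord.
move=> k /=; rewrite JE => /andP[k1 km].
by have := h (inord k.-1); rewrite mxE -B'S inordK ?prednK.
Qed.

(** * Quadratic forms of Gaussian vectors *)

Lemma quadratic_formE (R : realType) r (K : 'M[R]_r) (z : 'cV[R]_r) :
  (z^T *m K *m z) 0 0 = \sum_i \sum_j K i j * (z i 0 * z j 0).
Proof.
rewrite mxE exchange_big /=; apply: eq_bigr => j _.
rewrite mxE mulr_suml; apply: eq_bigr => i _.
by rewrite !mxE; ring.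
Qed.

Lemma tuple_measurable_quadratic_form (R : realType) r (K : 'M[R]_r) :
  tuple_measurable (fun z : 'cV[R]_r => (z^T *m K *m z) 0 0 : measurableTypeR R).
Proof.
rewrite /tuple_measurable (_ : (fun x => _) = fun x : r.-tuple (measurableTypeR R) =>
    let z := \col_l tnth x l in \sum_i \sum_j K i j * (z i 0 * z j 0)); last first.
  by apply/funext => x; rewrite quadratic_formE.
apply: measurable_sum => i; apply: measurable_sum => j.
by apply: measurable_funM => //; apply: measurable_funM;
  exact: tuple_measurable_coord.
Qed.

Section gaussian_quadratic_forms.
Context {R : realType} {d : measure_display} {T : measurableType d}.
Context {P : probability T R} {r : nat}.
Context (Z : T -> 'cV[R]_r).
Context (gZ : standard_gaussian P Z).
Local Notation RT := (measurableTypeR R).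
Local Notation gamma := (@normal_prob R 0 1).

Let mZ i : measurable_fun setT (fun t => Z t i 0 : RT) := (proj1 gZ) i.

Lemma standard_gaussian_second_moment i : (\int[P]_t (Z t i 0 ^+ 2)%:E <= 1)%E.
Proof.
rewrite (_ : \int[P]_t _ = \int[gamma]_x (x ^+ 2)%:E)%E.
  exact: normal_second_moment_le1.
have msq : measurable_fun setT (fun x : RT => (x ^+ 2)%:E).
  by apply/measurable_EFinP; exact: measurable_funX.
transitivity (\int[pushforward P (fun t => Z t i 0%R : RT)]_x (x ^+ 2)%:E)%E.
  rewrite (ge0_integral_pushforward (mZ i))//.
  by move=> x _; rewrite lee_fin sqr_ge0.
apply: eq_measure_integral => D mD _.
rewrite /= /pushforward.
pose B j : set RT := if j == i then D else setT.
have := (proj2 gZ) B; rewrite (bigD1 i)//= /B eqxx big1; last first.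
  by move=> j /negPf ->; exact: probability_setT.
rewrite mule1 => <-; last by move=> j; case: ifP.
congr (P _); apply/seteqP; split => t /=.
  by move=> Dt j; case: eqP => // ->.
by move=> /(_ i); rewrite eqxx.
Qed.

Definition weight (e : 'cV[R]_r -> R) : Prop :=
  tuple_measurable (e : 'cV[R]_r -> RT) /\ forall z, 0 <= e z <= 1.

Context (e : 'cV[R]_r -> R).
Context (we : weight e).

Let me_ : measurable_fun setT (fun t => e (Z t) : RT).
Proof. exact: tuple_measurable_comp gZ (proj1 we). Qed.

Definition weighted_moment i j : \bar R :=
  (\int[P]_t (e (Z t) * (Z t i 0 * Z t j 0))%:E)%E.

Let msq i : measurable_fun setT (fun t => (Z t i 0 ^+ 2)%:E).
Proof. by apply/measurable_EFinP; exact: (measurable_funX _ (mZ i)). Qed.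

Let intsq i : P.-integrable setT (fun t => (Z t i 0 ^+ 2)%:E).
Proof.
apply/integrableP; split; first exact: msq.
apply: (@le_lt_trans _ _ 1%E); last by rewrite ltry.
apply: le_trans (standard_gaussian_second_moment i).
apply: ge0_le_integral => //.
- by apply: measurableT_comp => //; exact: msq.
- by move=> t _; rewrite /= ger0_norm ?sqr_ge0.
Qed.

Lemma integrable_weighted i j :
  P.-integrable setT (fun t => (e (Z t) * (Z t i 0 * Z t j 0))%:E).
Proof.
apply: (le_integrable measurableT _ _
  (integrableD measurableT (intsq i) (intsq j))).
  apply/measurable_EFinP; apply: measurable_funM; first exact: me_.
  by apply: measurable_funM; exact: mZ.
move=> t _ /=; rewrite lee_fin normrM ger0_norm; last first.
  by case/andP: (proj2 we (Z t)).
rewrite [leRHS]ger0_norm ?addr_ge0 ?sqr_ge0//.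
have /andP[e0 e1] := proj2 we (Z t).
have h : `|Z t i 0 * Z t j 0| <= Z t i 0 ^+ 2 + Z t j 0 ^+ 2.
  by rewrite ler_norml; apply/andP; split; nra.
apply: le_trans h; rewrite -[leRHS]mul1r.
by apply: ler_wpM2r.
Qed.

Lemma weighted_moment_fin i j : weighted_moment i j \is a fin_num.
Proof. exact: (integrable_fin_num measurableT (integrable_weighted i j)). Qed.

Let tmoment i j :
  tuple_measurable (fun z : 'cV[R]_r => (e z * (z i 0 * z j 0))%:E).
Proof.
apply/measurable_EFinP; apply: measurable_funM; first exact: (proj1 we).
by apply: measurable_funM; exact: tuple_measurable_coord.
Qed.

(** The sign change of the coordinate j preserves the law and negates the
    moment. *)
Lemma weighted_moment_offdiag i j : i != j ->
  (forall z, e (reflection i j 1 0 *m z) = e z) -> weighted_moment i j = 0%E.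
Proof.
move=> ij ev.
have cs1 : (1 : R) ^+ 2 + 0 ^+ 2 = 1 by rewrite expr1n expr0n addr0.
have gZ' := standard_gaussian_reflection gZ ij cs1.
have := standard_gaussian_integral gZ gZ' (tmoment i j).
rewrite -/(weighted_moment i j).
have -> : (\int[P]_t (e (reflection i j 1 0 *m Z t) *
    ((reflection i j 1 0 *m Z t) i 0 * (reflection i j 1 0 *m Z t) j 0))%:E =
    (-1)%:E * weighted_moment i j)%E.
  rewrite /weighted_moment -integralZl//; last exact: integrable_weighted.
  apply: eq_integral => t _.
  rewrite ev !reflectionE !eqxx (eq_sym j) (negPf ij) -EFinM.
  by congr (_%:E); ring.
have /fineK <- := weighted_moment_fin i j.
by move: (fine _) => x; rewrite -EFinM => -[] h; congr (_%:E); lra.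
Qed.

(** The exchange of the coordinates i and j preserves the law. *)
Lemma weighted_moment_swap i j : i != j ->
  (forall z, e (reflection i j 0 1 *m z) = e z) ->
  weighted_moment i i = weighted_moment j j.
Proof.
move=> ij ev.
have cs1 : (0 : R) ^+ 2 + 1 ^+ 2 = 1 by rewrite expr1n expr0n add0r.
rewrite /weighted_moment.
have gZ' := standard_gaussian_reflection gZ ij cs1.
rewrite (standard_gaussian_integral gZ gZ' (tmoment i i)).
by apply: eq_integral => t _; rewrite ev !reflectionE eqxx !mul0r !add0r !mul1r.
Qed.

Let weighted_quadratic_formE (K : 'M[R]_r) t :
  (e (Z t) * ((Z t)^T *m K *m Z t) 0 0)%:E =
  (\sum_i \sum_j ((K i j)%:E * (e (Z t) * (Z t i 0%R * Z t j 0%R))%:E))%E.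
Proof.
rewrite quadratic_formE mulr_sumr -sumEFin.
apply: eq_bigr => i _; rewrite mulr_sumr -sumEFin; apply: eq_bigr => j _.
by rewrite -EFinM; congr (_%:E); ring.
Qed.

Let integrable_term (K : 'M[R]_r) i j : P.-integrable setT
  (fun t => ((K i j)%:E * (e (Z t) * (Z t i 0%R * Z t j 0%R))%:E)%E).
Proof. by apply: integrableZl => //; exact: integrable_weighted. Qed.

Lemma weighted_quadratic_form (K : 'M[R]_r) :
  (forall i j z, i != j -> e (reflection i j 1 0 *m z) = e z) ->
  (\int[P]_t (e (Z t) * ((Z t)^T *m K *m Z t) 0 0)%:E =
   \sum_i (K i i)%:E * weighted_moment i i)%E.
Proof.
move=> ev; under eq_integral do rewrite weighted_quadratic_formE.
rewrite integral_sum//; last by move=> i; exact: integrable_sum.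
apply: eq_bigr => i _; rewrite integral_sum// (bigD1 i)//= big1 ?adde0.
  by rewrite integralZl//; exact: integrable_weighted.
move=> j ji; rewrite integralZl//; last exact: integrable_weighted.
rewrite -/(weighted_moment i j) weighted_moment_offdiag ?mule0 1?eq_sym// => z.
by apply: ev; rewrite eq_sym.
Qed.

End gaussian_quadratic_forms.
Arguments weighted_moment {R d T} P {r}.

(** * Averaging a form over the axes orthogonal to its main direction *)

Section trace_averaging.
Context {R : realType} {d : measure_display} {T : measurableType d}.
Context {P : probability T R} {m : nat}.
Local Notation RT := (measurableTypeR R).
Implicit Types (K M : 'M[R]_m.+1) (z : 'cV[R]_m.+1) (a k : R).

(** The form whose positive part is integrated in [vartheta]. *)
Definition axis_form a k z : R :=
  a * z 0 0 ^+ 2 - k * \sum_(j < m) z (lift 0 j) 0 ^+ 2.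

Let axis_mx a k : 'M[R]_m.+1 :=
  diag_mx (\row_j (if j == 0 then a else - k)).

Let axis_mxE a k z : (z^T *m axis_mx a k *m z) 0 0 = axis_form a k z.
Proof.
rewrite quadratic_formE big_ord_recl; congr (_ + _).
  rewrite (bigD1 0)//= big1 ?addr0; last first.
    by move=> j /negPf j0; rewrite !mxE [_ == j]eq_sym j0 mulr0n mul0r.
  by rewrite !mxE eqxx mulr1n expr2.
rewrite mulr_sumr -sumrN; apply: eq_bigr => i _.
rewrite (bigD1 (lift 0 i))//= big1 ?addr0; last first.
  by move=> j /negPf j0; rewrite !mxE [_ == j]eq_sym j0 mulr0n mul0r.
by rewrite !mxE eqxx mulr1n /= expr2 mulNr.
Qed.

Definition axis_weight a k z : R := if 0 < axis_form a k z then 1 else 0.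

Lemma tuple_measurable_axis_form a k : tuple_measurable (axis_form a k : _ -> RT).
Proof.
have := tuple_measurable_quadratic_form (axis_mx a k); congr measurable_fun.
by apply/funext => x; rewrite axis_mxE.
Qed.

Lemma axis_weight_weight a k : weight (axis_weight a k).
Proof.
split; last by move=> z; rewrite /axis_weight; case: ltP; rewrite ?lexx ?ler01.
have mlt : measurable_fun setT
    (fun x : m.+1.-tuple RT => 0 < axis_form a k (\col_i tnth x i)).
  by apply: measurable_fun_ltr => //; exact: tuple_measurable_axis_form.
exact: measurable_fun_ifT.
Qed.

Let axis_weightE a k z :
  axis_weight a k z * (z^T *m axis_mx a k *m z) 0 0 =
  Num.max (axis_form a k z) 0.
Proof.
by rewrite axis_mxE /axis_weight; case: ltP => _; rewrite (mul1r, mul0r).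
Qed.

Let axis_weight_flip a k (i j : 'I_m.+1) z : i != j ->
  axis_weight a k (reflection i j 1 0 *m z) = axis_weight a k z.
Proof.
move=> ij; suff sq l : (reflection i j 1 0 *m z) l 0 ^+ 2 = z l 0 ^+ 2.
  congr (if 0 < _ - _ * _ then 1 else 0); rewrite ?sq//.
  by apply: eq_bigr => l _; rewrite sq.
rewrite reflectionE; have [->|_] := eqVneq l i.
  by rewrite mul1r mul0r addr0.
by have [->|_] := eqVneq l j; rewrite // mul1r mul0r sub0r sqrrN.
Qed.

Let axis_weight_swap a k (i j : 'I_m.+1) z : i != j -> i != 0 -> j != 0 ->
  axis_weight a k (reflection i j 0 1 *m z) = axis_weight a k z.
Proof.
move=> ij i0 j0; set y := reflection i j 0 1 *m z.
have cs1 : (0 : R) ^+ 2 + 1 ^+ 2 = 1 by rewrite expr1n expr0n add0r.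
have y0 : y 0 0 = z 0 0.
  by rewrite reflectionE !(eq_sym 0) (negPf i0) (negPf j0).
have sumE (x : 'cV[R]_m.+1) :
    \sum_(l < m) x (lift 0 l) 0 ^+ 2 = (x^T *m x) 0 0 - x 0 0 ^+ 2.
  rewrite mxE big_ord_recl !mxE -expr2 addrAC subrr add0r.
  by apply: eq_bigr => l _; rewrite mxE expr2.
congr (if 0 < _ - _ * _ then 1 else 0); first by rewrite y0.
rewrite !sumE y0 /y trmx_mul tr_reflection// -mulmxA (mulmxA (reflection _ _ _ _)).
by rewrite reflectionK// mul1mx.
Qed.

(** A positive part is at least the product of the form with any weight, and it is
    equal to it for the axis form and its own weight. This weight is invariant
    under sign changes of coordinates and exchanges of the coordinates other than
    0, so the weighted integral of a form depends only on its first diagonal entry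
    and on the sum of the other ones. *)
Lemma gaussian_trace_averaging (Z : T -> 'cV[R]_m.+1) K k :
  standard_gaussian P Z -> - (k * m%:R) <= \tr K - K 0 0 ->
  (\int[P]_t (Num.max (axis_form (K 0 0) k (Z t)) 0)%:E <=
   \int[P]_t (Num.max (((Z t)^T *m K *m Z t) 0 0) 0)%:E)%E.
Proof.
move=> gZ trK; set a := K 0 0.
have we := axis_weight_weight a k.
pose e := axis_weight a k.
pose q i := weighted_moment P Z (axis_weight a k) i i.
have qfin i : q i \is a fin_num by exact: weighted_moment_fin.
have intE M : (\int[P]_t (e (Z t) * ((Z t)^T *m M *m Z t) 0 0)%:E =
    (\sum_i M i i * fine (q i))%:E)%E.
  rewrite weighted_quadratic_form//; last first.
    by move=> i j z; exact: axis_weight_flip.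
  by rewrite -sumEFin; apply: eq_bigr => i _; rewrite EFinM fineK.
apply: (@le_trans _ _
    (\int[P]_t (e (Z t) * ((Z t)^T *m K *m Z t) 0 0)%:E)%E).
  rewrite (_ : \int[P]_t _ =
      \int[P]_t (e (Z t) * ((Z t)^T *m axis_mx a k *m Z t) 0 0)%:E)%E.
    rewrite !intE lee_fin !big_ord_recl !mxE eqxx mulr1n lerD2l.
    have [m0|m0] := posnP m.
      by rewrite !big1// => i _; have := ltn_ord i; rewrite {2}m0.
    pose c := fine (q (lift 0 (Ordinal m0))).
    have qc i : fine (q (lift 0 i)) = c.
      rewrite /c; congr fine; have [->//|ij] := eqVneq i (Ordinal m0).
      by apply: weighted_moment_swap => // z; apply: axis_weight_swap.
    have c0 : 0 <= c.
      rewrite fine_ge0// integral_ge0// => t _.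
      by rewrite lee_fin mulr_ge0 -?expr2 ?sqr_ge0// /axis_weight; case: ifP.
    under eq_bigr do rewrite qc.
    under [leRHS]eq_bigr do rewrite qc.
    rewrite -!mulr_suml ler_wpM2r//.
    move: trK; rewrite /mxtrace big_ord_recl addrAC subrr add0r; apply: le_trans.
    rewrite (eq_bigr (fun=> - k)) => [|i _]; last by rewrite !mxE eqxx.
    by rewrite sumr_const card_ord -mulNr mulr_natr.
  by apply: eq_integral => t _; rewrite axis_weightE.
have mq := tuple_measurable_comp gZ (tuple_measurable_quadratic_form K).
pose f t := (e (Z t) * ((Z t)^T *m K *m Z t) 0 0)%:E.
have mf : measurable_fun setT f.
  apply/measurable_EFinP; apply: measurable_funM => //.
  exact: tuple_measurable_comp gZ (proj1 we).
apply: (@le_trans _ _ (\int[P]_t (f^\+ t))%E).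
  by rewrite [X in (X <= _)%E]integralE -[leRHS]sube0 leeB// integral_ge0.
apply: ge0_le_integral => //.
- exact: measurable_funepos.
- by apply/measurable_EFinP; apply: measurable_maxr.
move=> t _; rewrite funeposE /f -EFin_max lee_fin.
rewrite /e /axis_weight; case: ltP => _; first by rewrite mul1r.
by rewrite mul0r maxxx le_max lexx orbT.
Qed.

End trace_averaging.

Section gaussian_bounds.
Context {R : realType} {d : measure_display} {T : measurableType d}.
Context {P : probability T R}.
Local Notation RT := (measurableTypeR R).

(** The off-diagonal moments vanish and the diagonal ones are at most 1. *)
Lemma gaussian_quadratic_form_le_trace r (Z : T -> 'cV[R]_r) (K : 'M[R]_r) :
  standard_gaussian P Z -> (forall i, 0 <= K i i) ->
  (\int[P]_t (((Z t)^T *m K *m Z t) 0 0)%:E <= (\tr K)%:E)%E.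
Proof.
move=> gZ K0; pose e (z : 'cV[R]_r) : R := 1.
have we : weight e.
  by split=> [|z]; [exact: measurable_cst|rewrite /e lexx ler01].
rewrite (_ : \int[P]_t _ =
    \int[P]_t (e (Z t) * ((Z t)^T *m K *m Z t) 0 0)%:E)%E; last first.
  by apply: eq_integral => t _; rewrite mul1r.
rewrite (weighted_quadratic_form gZ we)// /mxtrace -sumEFin.
apply: lee_sum => i _; rewrite -[leRHS]mule1.
apply: lee_wpmul2l; first by rewrite lee_fin.
rewrite [leLHS](_ : _ = \int[P]_t (Z t i 0 ^+ 2)%:E)%E.
  exact: standard_gaussian_second_moment.
by apply: eq_integral => t _; rewrite mul1r expr2.
Qed.

(** A product of reflections turns u into the first axis, and preserves the law of
    Z and the trace of M. *)
Lemma gaussian_positive_part_bound m (Z : T -> 'cV[R]_m.+1) (M : 'M[R]_m.+1)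
    (u : 'cV[R]_m.+1) (rho : R) :
  standard_gaussian P Z -> (u^T *m u) 0 0 = 1 ->
  (u^T *m M *m u) 0 0 - rho <= \tr M ->
  (\int[P]_t (Num.max (axis_form ((u^T *m M *m u) 0 0) (rho / m%:R) (Z t)) 0)%:E <=
   \int[P]_t (Num.max (((Z t)^T *m M *m Z t) 0 0) 0)%:E)%E.
Proof.
move=> gZ u1 trM.
have [Q QP [x Qu]] := reflection_to_axis u.
have QQ := reflection_product_orthogonal QP.
have QQ' : Q *m Q^T = 1%:M by exact: mulmx1C.
pose K := Q *m M *m Q^T.
have uE : u = x *: (Q^T *m delta_mx 0 0).
  by rewrite scalemxAr -Qu mulmxA QQ mul1mx.
have quad_axis (A : 'M[R]_m.+1) : (u^T *m A *m u) 0 0 =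
    x ^+ 2 * (Q *m A *m Q^T) 0 0.
  rewrite uE quadratic_formZ; congr (_ * _).
  by rewrite -[in RHS]delta_formE trmx_mul trmxK !mulmxA.
have x1 : x ^+ 2 = 1.
  by move: u1; rewrite -[u^T]mulmx1 quad_axis mulmx1 QQ' mxE eqxx mulr1.
have K00 : K 0 0 = (u^T *m M *m u) 0 0 by rewrite quad_axis x1 mul1r.
have trK : \tr K = \tr M by rewrite /K mxtrace_mulC mulmxA QQ mul1mx.
rewrite -K00.
have gQZ := standard_gaussian_reflection_product gZ QP.
apply: (@le_trans _ _ (\int[P]_t
    (Num.max (((Q *m Z t)^T *m K *m (Q *m Z t)) 0 0) 0)%:E)%E); last first.
  rewrite le_eqVlt; apply/orP; left; apply/eqP; apply: eq_integral => t _.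
  have KM : Q^T *m K *m Q = M by rewrite /K !mulmxA QQ mul1mx -mulmxA QQ mulmx1.
  by rewrite -[in RHS]KM trmx_mul !mulmxA.
rewrite (_ : \int[P]_t _ = \int[P]_t
    (Num.max (axis_form (K 0 0) (rho / m%:R) (Q *m Z t)) 0)%:E)%E.
  apply: gaussian_trace_averaging => //.
  have [m0|m0] := posnP m.
    rewrite [X in _ * X%:R]m0 mulr0 oppr0 /mxtrace big_ord_recl.
    rewrite big1 ?addr0 ?subrr// => i _.
    by have := ltn_ord i; rewrite {2}m0.
  rewrite mulfVK ?pnatr_eq0 -?lt0n// trK K00.
  by rewrite lerBrDr addrC.
apply: (standard_gaussian_integral gZ gQZ
  (f := fun z => (Num.max (axis_form (K 0 0) (rho / m%:R) z) 0)%:E)).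
apply/measurable_EFinP; apply: measurable_maxr => //.
exact: tuple_measurable_axis_form.
Qed.

End gaussian_bounds.

(** * Gaussian rounding of a solution of the relaxation *)

Section rounding.
Context {R : realType} {d : measure_display} {T : measurableType d}.
Context {P : probability T R} {n m : nat}.
Local Notation RT := (measurableTypeR R).

(** The expected squared length of W Z is at most the trace of X, and the i-th term
    of the thresholded energy, extended homogeneously, is at W Z the positive part
    of a compressed form at Z. *)
Lemma gaussian_rounding (A X : 'M[R]_n.+1) rho (W : 'M[R]_(n.+1, m.+1))
    (Z : T -> 'cV[R]_m.+1) (M : R) :
  psd X -> X = W *m W^T -> \tr X = 1 -> 0 < rho -> standard_gaussian P Z ->
  (forall z, (z^T *m z) 0 0 = 1 -> thresholded_energy A rho z <= M) ->
  (\int[P]_t (Num.max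
       (axis_form (psi_objective A rho X) (n.+1%:R * rho / m%:R) (Z t)) 0)%:E
    <= M%:E)%E.
Proof.
move=> pX XW trX rho0 gZ hM.
pose s i :=
  tr_pos (psd_sqrt X *m col i A *m (col i A)^T *m psd_sqrt X - rho *: X).
pose C i := compressed_form W (col i A) rho.
have M0 : 0 <= M.
  apply: le_trans (hM _ (delta_unit 0)).
  by rewrite sumr_ge0// => i _; rewrite le_max lexx orbT.
have mform a k :
    measurable_fun setT (fun t => (Num.max (axis_form a k (Z t)) 0)%:E).
  apply/measurable_EFinP; apply: measurable_maxr => //.
  exact: tuple_measurable_comp gZ (tuple_measurable_axis_form a k).
have mquad K : measurable_fun setT (fun t => ((Z t)^T *m K *m Z t) 0 0 : RT).
  exact: tuple_measurable_comp gZ (tuple_measurable_quadratic_form K).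
have mC i :
    measurable_fun setT (fun t => (Num.max (((Z t)^T *m C i *m Z t) 0 0) 0)%:E).
  by apply/measurable_EFinP; apply: measurable_maxr => //; exact: mquad.
have max0 (x : R) : (0 <= (Num.max x 0)%:E)%E.
  by rewrite lee_fin le_max lexx orbT.
(* The positive part of a sum is at most the sum of the positive parts. *)
apply: (@le_trans _ _
    (\int[P]_t \sum_i (Num.max (axis_form (s i) (rho / m%:R) (Z t)) 0)%:E)%E).
  apply: ge0_le_integral => //.
    by apply: emeasurable_sum => i.
  move=> t _; rewrite sumEFin lee_fin.
  have -> : axis_form (psi_objective A rho X) (n.+1%:R * rho / m%:R) (Z t) =
      \sum_i axis_form (s i) (rho / m%:R) (Z t).
    rewrite /axis_form sumrB -mulr_suml; congr (_ - _).
    by rewrite sumr_const card_ord -[RHS]mulr_natl !mulrA.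
  rewrite ge_max sumr_ge0 ?andbT; last by move=> i _; rewrite le_max lexx orbT.
  by apply: ler_sum => i _; rewrite le_max lexx.
rewrite ge0_integral_sum//.
apply: (@le_trans _ _
    (\sum_i \int[P]_t (Num.max (((Z t)^T *m C i *m Z t) 0 0) 0)%:E)%E).
  apply: lee_sum => i _.
  have [si0|[u u1 us]] := tr_pos_compressed (col i A) pX XW rho0.
    rewrite [X in (X <= _)%E](_ : _ = 0%E); first exact: integral_ge0.
    rewrite -(integral0 P setT); apply: eq_integral => t _; congr (_%:E).
    rewrite /s si0 /axis_form mul0r sub0r max_r// oppr_le0 mulr_ge0//.
      by rewrite divr_ge0 ?(ltW rho0).
    by rewrite sumr_ge0// => j _; exact: sqr_ge0.
  rewrite /s -us; apply: gaussian_positive_part_bound => //.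
  by apply: compressed_form_trace => //; rewrite -XW.
rewrite -ge0_integral_sum//.
apply: (@le_trans _ _
    (\int[P]_t (M%:E * (((Z t)^T *m (W^T *m W) *m Z t) 0 0)%:E))%E).
  have quadE t : ((Z t)^T *m (W^T *m W) *m Z t) 0 0 =
      ((W *m Z t)^T *m (W *m Z t)) 0 0.
    by rewrite trmx_mul !mulmxA.
  apply: ge0_le_integral => //.
  - by move=> t _; apply: sume_ge0.
  - by apply: emeasurable_sum => i.
  - by apply: emeasurable_funM => //; apply/measurable_EFinP; exact: mquad.
  move=> t _; rewrite sumEFin -EFinM lee_fin quadE.
  under eq_bigr do rewrite compressed_formE.
  exact: thresholded_energy_homogeneous.
have quad0 t : (0 <= (((Z t)^T *m (W^T *m W) *m Z t) 0 0)%:E)%E.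
  have := proj2 (mul_tr_psd W^T) (Z t); rewrite trmxK lee_fin; exact.
rewrite ge0_integralZl//; last by apply/measurable_EFinP; exact: mquad.
rewrite -[leRHS]mule1; apply: lee_wpmul2l; first by rewrite lee_fin.
apply: le_trans (gaussian_quadratic_form_le_trace gZ _) _; last first.
  by rewrite mxtrace_mulC -XW trX.
move=> i; have := psd_diag_ge0 i (mul_tr_psd W^T).
by rewrite trmxK.
Qed.

End rounding.

Theorem proposition3p1 (R : realType) (n : nat) (Sigma A : 'M[R]_n) (rho : R)
    (hSigma : psd Sigma) (hA : Sigma = A^T *m A)
    (hrho0 : 0 < rho) (hrho : forall i : 'I_n, rho < Sigma i i)
    (X : 'M[R]_n) (hX : psi_optimal A rho X)
    (r : nat) (hr : r = \rank X)
    (d : measure_display) (T : measurableType d) (P : probability T R)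
    (xi : nat -> {RV P >-> R})
    (hindep : mutually_independent [set i : nat | (1 <= i <= r)%N] xi)
    (hnormal : forall i : nat, (1 <= i <= r)%N -> standard_normal (xi i)) :
  ((n%:R * rho)%:E * vartheta xi r (psi A rho / (n%:R * rho))
     <= (phi Sigma rho)%:E)%E /\
  phi Sigma rho <= psi A rho.
Proof.
have [[pX trX] Xopt] := hX.
have psiE : psi A rho = psi_objective A rho X.
  apply: max_ofE; first by exists X; [split|].
  by move=> _ [Y fY <-]; exact: Xopt.
case: n => [|n] in Sigma A X hSigma hA hrho hX hr pX trX Xopt psiE *.
  by move: trX; rewrite /mxtrace big_ord0 => /esym/eqP; rewrite oner_eq0.
have [c c1 [phiE phi_ub]] := phi_eq_max hA hrho0 hrho.
split; last first.
  have feas : psi_feasible (c *m c^T).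
    by split; [exact: mul_tr_psd|rewrite mxtrace_mulC -trace_mx11 in c1 *].
  rewrite psiE phiE; apply: le_trans (Xopt _ feas).
  by apply: ler_sum => i _; exact: tr_pos_outer_ge.
(* The rank is positive, since the trace is. *)
case: r hr hindep hnormal => [/esym/eqP|m hr hindep hnormal].
  rewrite mxrank_eq0 => /eqP X0; move: trX; rewrite X0 mxtrace0 => /esym/eqP.
  by rewrite oner_eq0.
have [W XW] := @psd_factorization _ _ m.+1 X pX (eq_leq (esym hr)).
have gZ := independent_normal_standard_gaussian hindep hnormal.
have := gaussian_rounding pX XW trX hrho0 gZ phi_ub; apply: le_trans.
(* The factor n rho > 0 is moved inside the positive part. *)
have c0 : 0 < n.+1%:R * rho by rewrite mulr_gt0.
rewrite /vartheta unlock -ge0_integralZl//; first last.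
- by rewrite lee_fin ltW.
- by move=> t _; rewrite lee_fin le_max lexx orbT.
- apply/measurable_EFinP; apply: measurable_maxr => //.
  apply: measurable_funB; (apply: measurable_funM; first exact: measurable_cst).
    by apply: measurable_funX; exact: measurable_funP.
  by apply: measurable_sum => j; apply: measurable_funX; exact: measurable_funP.
rewrite le_eqVlt; apply/orP; left; apply/eqP; apply: eq_integral => t _.
rewrite -EFinM maxr_pMr ?(ltW c0)// mulr0; congr (Num.max _ _)%:E.
rewrite mulrBr /axis_form mxE; congr (_ - _).
  by rewrite mulrA [_ * (_ / _)]mulrC psiE divfK ?gt_eqF.
rewrite (_ : m.+1%:R - 1 = m%:R); last by rewrite -natr1 addrK.
rewrite mulrA; congr (_ * _).
rewrite !big_add1 /= big_mkord; apply: eq_bigr => j _.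
by rewrite mxE.
Qed.
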